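(* Let $n\ge3$ and let $\alpha=(\alpha_1,\dots,\alpha_n)\in(0,2\pi)^n$. If $2(n-1)\pi<\sum_{i=1}^n\alpha_i<2n\pi$, then the set $\mathrm{Rep}^{SM}_\alpha(\Sigma_{0,n},G)$ of super-maximal classes forms a non-empty compact connected component of $\mathrm{Rep}_\alpha(\Sigma_{0,n},G)$, where $G=\mathrm{PSL}(2,\mathbb R)$.
   Context: $\Sigma_{0,n}$ is the oriented sphere minus $n$ points (punctures). $G=\mathrm{PSL}(2,\mathbb R)$ acts by orientation-preserving isometries on $\mathbb H^+=\{\Im z>0\}$ with the metric $(dx^2+dy^2)/y^2$. The $c_i\in\pi_1(\Sigma_{0,n})$, $1\le i\le n$, are elements freely homotopic to positive loops around the punctures. The function $\theta:G\to[0,2\pi]$ is: $\theta(g)=0$ if $g$ is hyperbolic or positive parabolic (a parabolic translating its horocycles anti-clockwise, i.e. conjugate in $G$ to $z\mapsto z+1$); $\theta(g)=2\pi$ if $g$ is negative parabolic (the other parabolics) or the identity; $\theta(g)\in(0,2\pi)$ is the rotation angle of $g$ on $\mathbb H^+$ if $g$ is elliptic. Put $\theta_i(\rho)=\theta(\rho(c_i))$ and $\Theta(\rho)=\sum_{i=1}^n\theta_i(\rho)$. The volume $\mathrm{Vol}(\rho)$ is $\int_{\Sigma_{0,n}} f^*\big(\frac{dx\wedge dy}{y^2}\big)$ for a smooth $\rho$-equivariant map $f:\widetilde{\Sigma_{0,n}}\to\mathbb H^+$ such that, near each puncture, the completion of $f^*\big(\frac{dx^2+dy^2}{y^2}\big)$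 is a cone, a parabolic cusp, or an annulus with totally geodesic boundary. Equivalently (known formula of Burger--Iozzi--Wienhard), $\mathrm{Vol}(\rho)=-\sum_{i=1}^n T(\tilde\rho(c_i))$, where $\tilde\rho$ is any lift of $\rho$ to the universal cover $\widetilde G$ of $G$ and $T(g)=\lim_k (g^k(x)-x)/k$ is the translation number, $\widetilde{\mathbb R\mathbf P^1}$ being identified with $\mathbb R$ (oriented anti-clockwise as the boundary of $\mathbb H^+$) so that the positive generator of the covering group is $x\mapsto x+2\pi$. The relative Euler class is $\mathbf{eu}(\rho)=\frac1{2\pi}\big(\mathrm{Vol}(\rho)+\Theta(\rho)\big)\in\mathbb Z$. A representation $\rho:\pi_1(\Sigma_{0,n})\to G$ is super-maximal if $\mathbf{eu}(\rho)=n-1$ or $\mathbf{eu}(\rho)=n$. $\mathrm{Rep}_\alpha(\Sigma_{0,n},G)\subset \mathrm{Hom}(\pi_1(\Sigma_{0,n}),G)/G$ (quotient by conjugation, quotient topology) is the set of conjugacy classes of $\rho$ with $\theta_i(\rho)=\alpha_i$ for all $i$, and $\mathrm{Rep}^{SM}_\alpha(\Sigma_{0,n},G)$ is its subset of classes of super-maximal representations. *)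

(* Defs.v *)
From HB Require Import structures.
From mathcomp Require Import all_boot all_order all_algebra.
From mathcomp Require Import generic_quotient complex.
From mathcomp Require Import all_classical all_reals all_analysis.
Import numFieldNormedType.Exports.
Import Order.TTheory GRing.Theory Num.Theory.

Set Implicit Arguments.
Unset Strict Implicit.
Unset Printing Implicit Defensive.

Local Open Scope classical_set_scope.
Local Open Scope quotient_scope.
Local Open Scope ring_scope.

(* The fundamental group of the n-punctured sphere, by its standard
   presentation < c_1, ..., c_n | c_1 c_2 ... c_n = 1 >.  Words are sequences
   of letters (i, b), where (i, false) stands for c_i and (i, true) for its
   inverse; indices start at 0. *)

Definition letter (n : nat) : Type := 'I_n * bool.

Definition letter_inv (n : nat) (l : letter n) : letter n := (l.1, ~~ l.2).

Inductive word_eq (n : nat) : seq (letter n) -> seq (letter n) -> Prop :=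
| word_eq_refl u : word_eq u u
| word_eq_sym u v : word_eq u v -> word_eq v u
| word_eq_trans u v w : word_eq u v -> word_eq v w -> word_eq u w
| word_eq_cat u u' v v' :
    word_eq u u' -> word_eq v v' -> word_eq (u ++ v) (u' ++ v')
| word_eq_cancel l : word_eq [:: l; letter_inv l] [::]
| word_eq_relator : word_eq [seq (i, false) | i <- enum 'I_n] [::].

Section PuncturedSphereGroup.
Variable n : nat.

Let word := seq ('I_n * bool).

Definition word_eqb (u v : word) : bool := `[< word_eq u v >].

Lemma word_eqb_refl : reflexive word_eqb.
Proof. by move=> u; apply/asboolP; exact: word_eq_refl. Qed.

Lemma word_eqb_sym : symmetric word_eqb.
Proof.
by move=> u v; apply/asboolP/asboolP => uv; exact: word_eq_sym.
Qed.

Lemma word_eqb_trans : transitive word_eqb.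
Proof.
move=> v u w /asboolP uv /asboolP vw.
by apply/asboolP; exact: word_eq_trans uv vw.
Qed.

Canonical word_equiv :=
  EquivRel word_eqb word_eqb_refl word_eqb_sym word_eqb_trans.

Definition sphere_group : Type := {eq_quot word_equiv}.

HB.instance Definition _ := Choice.on sphere_group.
HB.instance Definition _ := Quotient.on sphere_group.

Implicit Types (x y : sphere_group) (u v : word).

Definition word_inv u : word := rev [seq letter_inv l | l <- u].

Definition sphere_mul x y : sphere_group := \pi_sphere_group (repr x ++ repr y).
Definition sphere_inv x : sphere_group := \pi_sphere_group (word_inv (repr x)).
Definition sphere_one : sphere_group := \pi_sphere_group [::].

Lemma pi_word_eq u v :
  \pi_sphere_group u = \pi_sphere_group v <-> word_eq u v.
Proof.
by split=> [/eqmodP /asboolP|uv] //; apply/eqmodP/asboolP.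
Qed.

Lemma repr_pi_word u : word_eq (repr (\pi_sphere_group u)) u.
Proof. by apply/pi_word_eq; rewrite reprK. Qed.

Lemma word_eq_invr u : word_eq (u ++ word_inv u) [::].
Proof.
elim: u => [|l u IHu]; first exact: word_eq_refl.
rewrite /word_inv /= rev_cons -cats1 /= -cat1s catA.
rewrite -[_ ++ rev _ ++ _]/([:: l] ++ (u ++ (word_inv u ++ [:: letter_inv l]))).
apply: word_eq_trans (word_eq_cancel l).
rewrite -[[:: l; _]]/([:: l] ++ ([::] ++ [:: letter_inv l])).
apply: word_eq_cat; first exact: word_eq_refl.
rewrite catA.
by apply: word_eq_cat; [exact: IHu|exact: word_eq_refl].
Qed.

Lemma word_invK : involutive word_inv.
Proof.
move=> u; rewrite /word_inv map_rev revK -map_comp map_id_in// => -[i b] _ /=.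
by rewrite /letter_inv /= negbK.
Qed.

Lemma sphere_mulA : associative sphere_mul.
Proof.
move=> x y z; apply/pi_word_eq.
apply: (@word_eq_trans _ _ (repr x ++ (repr y ++ repr z))).
  by apply: word_eq_cat; [exact: word_eq_refl|exact: repr_pi_word].
rewrite catA; apply: word_eq_cat; last exact: word_eq_refl.
exact/word_eq_sym/repr_pi_word.
Qed.

Lemma sphere_mul1 : left_id sphere_one sphere_mul.
Proof.
move=> x; rewrite -[RHS]reprK; apply/pi_word_eq.
rewrite -[in X in word_eq _ X](cat0s (repr x)).
by apply: word_eq_cat; [exact: repr_pi_word|exact: word_eq_refl].
Qed.

Lemma sphere_mulr1 : right_id sphere_one sphere_mul.
Proof.
move=> x; rewrite -[RHS]reprK; apply/pi_word_eq.
rewrite -[in X in word_eq _ X](cats0 (repr x)).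
by apply: word_eq_cat; [exact: word_eq_refl|exact: repr_pi_word].
Qed.

Lemma sphere_mulVr : right_inverse sphere_one sphere_inv sphere_mul.
Proof.
move=> x; apply/pi_word_eq; apply: word_eq_trans (word_eq_invr (repr x)).
by apply: word_eq_cat; [exact: word_eq_refl|exact: repr_pi_word].
Qed.

Lemma sphere_mulVl : left_inverse sphere_one sphere_inv sphere_mul.
Proof.
move=> x; apply/pi_word_eq.
apply: word_eq_trans (word_eq_invr (word_inv (repr x))); rewrite word_invK.
by apply: word_eq_cat; [exact: repr_pi_word|exact: word_eq_refl].
Qed.

HB.instance Definition _ := isGroup.Build sphere_group
  sphere_mulA sphere_mul1 sphere_mulr1 sphere_mulVl sphere_mulVr.

Definition puncture_loop (i : 'I_n) : sphere_group :=
  \pi_sphere_group [:: (i, false)].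

End PuncturedSphereGroup.

(* PSL(2, R) is SL(2, R) modulo {1, -1}, with the quotient of the topology
   induced from 2 x 2 matrices. *)

Section PSL2.
Variable R : realType.

Definition SL2 : Type := set_type [set M : 'M[R]_2 | \det M = 1].

HB.instance Definition _ := Topological.on SL2.

Definition toSL2 (M : 'M[R]_2) (detM : \det M = 1) : SL2 :=
  exist _ M (mem_set detM).

Definition SL2_mx (A : SL2) : 'M[R]_2 := set_val A.

Lemma det_SL2 (A : SL2) : \det (SL2_mx A) = 1.
Proof. by case: A => M MP; exact: (set_mem MP). Qed.

Lemma SL2_mx_inj : injective SL2_mx.
Proof. exact: val_inj. Qed.

Lemma SL2_unit (A : SL2) : SL2_mx A \in unitmx.
Proof. by rewrite unitmxE det_SL2 unitr1. Qed.

Lemma SL2_mul_subproof (A B : SL2) : \det (SL2_mx A *m SL2_mx B) = 1.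
Proof. by rewrite det_mulmx !det_SL2 mulr1. Qed.

Lemma SL2_inv_subproof (A : SL2) : \det (invmx (SL2_mx A)) = 1.
Proof. by rewrite det_inv det_SL2 invr1. Qed.

Definition SL2_one : SL2 := toSL2 (det1 R 2).
Definition SL2_mul (A B : SL2) : SL2 := toSL2 (SL2_mul_subproof A B).
Definition SL2_inv (A : SL2) : SL2 := toSL2 (SL2_inv_subproof A).

Lemma SL2_mx_mul (A B : SL2) : SL2_mx (SL2_mul A B) = SL2_mx A *m SL2_mx B.
Proof. by []. Qed.

Definition pm_eq (A B : SL2) : bool :=
  (SL2_mx A == SL2_mx B) || (SL2_mx A == - SL2_mx B).

Lemma pm_eq_refl : reflexive pm_eq.
Proof. by move=> A; rewrite /pm_eq eqxx. Qed.

Lemma pm_eq_sym : symmetric pm_eq.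
Proof.
by move=> A B; rewrite /pm_eq eq_sym; congr orb; rewrite eq_sym eqr_oppLR.
Qed.

Lemma pm_eq_trans : transitive pm_eq.
Proof.
move=> B A C; rewrite /pm_eq => /orP[] /eqP-> //.
by move=> /orP[] /eqP->; rewrite ?opprK eqxx ?orbT.
Qed.

Canonical pm_equiv := EquivRel pm_eq pm_eq_refl pm_eq_sym pm_eq_trans.

Definition PSL2 : Type := quotient_topology {eq_quot pm_equiv}.

HB.instance Definition _ := Topological.on PSL2.
HB.instance Definition _ := Quotient.on PSL2.

Lemma pi_pm_eq (A B : SL2) : \pi_PSL2 A = \pi_PSL2 B <-> pm_eq A B.
Proof. by split=> [/eqmodP|AB]; last apply/eqmodP. Qed.

Lemma repr_pi_pm (A : SL2) : pm_eq (repr (\pi_PSL2 A)) A.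
Proof. by apply/pi_pm_eq; rewrite reprK. Qed.

Lemma pm_eq_mul (A A' B B' : SL2) :
  pm_eq A A' -> pm_eq B B' -> pm_eq (SL2_mul A B) (SL2_mul A' B').
Proof.
rewrite /pm_eq !SL2_mx_mul => /orP[] /eqP-> /orP[] /eqP->;
  by rewrite ?mulmxN ?mulNmx ?opprK eqxx ?orbT.
Qed.

Lemma pm_eqE (A B : SL2) : SL2_mx A = SL2_mx B -> pm_eq A B.
Proof. by move=> /eqP AB; rewrite /pm_eq AB. Qed.

Definition PSL2_mul (g h : PSL2) : PSL2 := \pi_PSL2 (SL2_mul (repr g) (repr h)).
Definition PSL2_inv (g : PSL2) : PSL2 := \pi_PSL2 (SL2_inv (repr g)).
Definition PSL2_one : PSL2 := \pi_PSL2 SL2_one.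

Lemma PSL2_mulA : associative PSL2_mul.
Proof.
move=> x y z; apply/pi_pm_eq.
apply: (@pm_eq_trans (SL2_mul (repr x) (SL2_mul (repr y) (repr z)))).
  by apply: pm_eq_mul; [exact: pm_eq_refl|exact: repr_pi_pm].
apply: (@pm_eq_trans (SL2_mul (SL2_mul (repr x) (repr y)) (repr z))).
  by apply: pm_eqE; exact: mulmxA.
apply: pm_eq_mul; last exact: pm_eq_refl.
by rewrite pm_eq_sym; exact: repr_pi_pm.
Qed.

Lemma PSL2_mul1 : left_id PSL2_one PSL2_mul.
Proof.
move=> x; rewrite -[RHS]reprK; apply/pi_pm_eq.
apply: (@pm_eq_trans (SL2_mul SL2_one (repr x))).
  by apply: pm_eq_mul; [exact: repr_pi_pm|exact: pm_eq_refl].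
by apply: pm_eqE; exact: mul1mx.
Qed.

Lemma PSL2_mulr1 : right_id PSL2_one PSL2_mul.
Proof.
move=> x; rewrite -[RHS]reprK; apply/pi_pm_eq.
apply: (@pm_eq_trans (SL2_mul (repr x) SL2_one)).
  by apply: pm_eq_mul; [exact: pm_eq_refl|exact: repr_pi_pm].
by apply: pm_eqE; exact: mulmx1.
Qed.

Lemma PSL2_mulVl : left_inverse PSL2_one PSL2_inv PSL2_mul.
Proof.
move=> x; apply/pi_pm_eq.
apply: (@pm_eq_trans (SL2_mul (SL2_inv (repr x)) (repr x))).
  by apply: pm_eq_mul; [exact: repr_pi_pm|exact: pm_eq_refl].
by apply: pm_eqE; exact: mulVmx (SL2_unit _).
Qed.

Lemma PSL2_mulVr : right_inverse PSL2_one PSL2_inv PSL2_mul.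
Proof.
move=> x; apply/pi_pm_eq.
apply: (@pm_eq_trans (SL2_mul (repr x) (SL2_inv (repr x)))).
  by apply: pm_eq_mul; [exact: pm_eq_refl|exact: repr_pi_pm].
by apply: pm_eqE; exact: mulmxV (SL2_unit _).
Qed.

HB.instance Definition _ := isGroup.Build PSL2
  PSL2_mulA PSL2_mul1 PSL2_mulr1 PSL2_mulVl PSL2_mulVr.

(* A matrix representing g, defined up to sign; everything below is
   insensitive to that sign. *)
Definition PSL2_mx (g : PSL2) : 'M[R]_2 := SL2_mx (repr g).

End PSL2.

Section Theta.
Variable R : realType.
Implicit Types (g h : PSL2 R) (t : R).

Local Notation C := (R[i]^o)%type.

(* z |-> (a z + b) / (c z + d); total on the complex numbers, but only used
   on the upper half-plane, where the denominator does not vanish. *)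
Definition moebius g (z : C) : C :=
  let M := PSL2_mx g in
  (((M 0 0)%:C * z + (M 0 1)%:C) / ((M 1 0)%:C * z + (M 1 1)%:C))%C.

Definition upper_half_plane : set C := [set z : C | 0 < complex.Im z].

Definition hyperbolic g : Prop := 2 < `|\tr (PSL2_mx g)|.

Definition parabolic g : Prop := g <> 1%g /\ `|\tr (PSL2_mx g)| = 2.

Definition is_unit_translation g : Prop :=
  forall z : C, upper_half_plane z -> moebius g z = z + 1.

Definition positive_parabolic g : Prop :=
  exists h, is_unit_translation (g ^ h)%g.

Definition negative_parabolic g : Prop :=
  parabolic g /\ ~ positive_parabolic g.

(* g fixes a point of the upper half-plane and its differential there is the
   rotation of (anticlockwise) angle t. *)
Definition has_rotation_angle g t : Prop :=
  exists z : C, [/\ upper_half_plane z, moebius g z = z &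
    is_derive z 1 (moebius g) (Complex (cos t) (sin t))].

Definition theta g : R :=
  if `[< hyperbolic g \/ positive_parabolic g >] then 0
  else if `[< negative_parabolic g \/ g = 1%g >] then 2 * pi
  else get [set t : R | 0 < t < 2 * pi /\ has_rotation_angle g t].

End Theta.

(* The universal cover of PSL(2, R) is realized as the group of continuous
   lifts, to the universal cover R of RP^1, of the projective action. *)

Section UniversalCover.
Variable R : realType.

(* The real number x covers the point of RP^1 with affine coordinate
   tan (x / 2); this increases with x, so R is oriented as the boundary of the
   upper half-plane, and the deck group is generated by x |-> x + 2 pi. *)
Definition RP1_vec (x : R) : 'cV[R]_2 :=
  \col_i (if i == 0 then sin (x / 2) else cos (x / 2)).

Definition is_lift (g : PSL2 R) (F : R -> R) : Prop :=
  continuous F /\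
  forall x : R, exists2 k : R, k != 0 &
    PSL2_mx g *m RP1_vec x = k *: RP1_vec (F x).

Definition translation_number (F : R -> R) : R :=
  limn (fun k : nat => (iter k F 0 - 0) / k%:R).

End UniversalCover.

Section Representations.
Variables (R : realType) (n : nat).

Local Notation Pi := (sphere_group n).
Local Notation G := (PSL2 R).

(* Hom(pi_1, G), with the topology of pointwise convergence *)
Definition HomPi : Type :=
  set_type [set rho : {ptws Pi -> G} | {morph rho : x y / (x * y)%g}].

HB.instance Definition _ := Topological.on HomPi.

Definition HomPi_fun (rho : HomPi) : Pi -> G := set_val rho.
Coercion HomPi_fun : HomPi >-> Funclass.

Implicit Types rho sigma : HomPi.

Definition is_lift_rep rho (rhot : Pi -> R -> R) : Prop :=
  (forall x : Pi, is_lift (rho x) (rhot x)) /\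
  (forall x y : Pi, rhot (x * y)%g = rhot x \o rhot y).

(* Volume through the formula of Burger--Iozzi--Wienhard; the value does not
   depend on the lift, so that the set below is a singleton. *)
Definition Vol rho : R :=
  get [set v : R | exists rhot, is_lift_rep rho rhot /\
    v = - \sum_(i < n) translation_number (rhot (puncture_loop i))].

Definition theta_i rho (i : 'I_n) : R := theta (rho (puncture_loop i)).

Definition Theta rho : R := \sum_(i < n) theta_i rho i.

Definition euler rho : R := (2 * pi)^-1 * (Vol rho + Theta rho).

Definition super_maximal rho : Prop :=
  euler rho = n%:R - 1 \/ euler rho = n%:R.

Definition conj_eqb rho sigma : bool :=
  `[< exists g : G, forall x, sigma x = (rho x ^ g)%g >].

Lemma conj_eqb_refl : reflexive conj_eqb.
Proof. by move=> rho; apply/asboolP; exists 1%g => x; rewrite conjg1. Qed.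

Lemma conj_eqb_sym : symmetric conj_eqb.
Proof.
by move=> rho sigma; apply/asboolP/asboolP => -[g e]; exists (g^-1)%g => x;
  rewrite e -conjgM mulgV conjg1.
Qed.

Lemma conj_eqb_trans : transitive conj_eqb.
Proof.
move=> sigma rho tau /asboolP[g eg] /asboolP[h eh]; apply/asboolP.
by exists (g * h)%g => x; rewrite eh eg conjgM.
Qed.

Canonical conj_equiv :=
  EquivRel conj_eqb conj_eqb_refl conj_eqb_sym conj_eqb_trans.

Definition rep_space : Type := quotient_topology {eq_quot conj_equiv}.

HB.instance Definition _ := Topological.on rep_space.
HB.instance Definition _ := Quotient.on rep_space.

Definition Rep (alpha : 'I_n -> R) : set rep_space :=
  [set \pi_rep_space rho | rho in
    [set rho | forall i, theta_i rho i = alpha i]].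

Definition RepSM (alpha : 'I_n -> R) : set rep_space :=
  [set \pi_rep_space rho | rho in
    [set rho | (forall i, theta_i rho i = alpha i) /\ super_maximal rho]].

End Representations.

Definition is_connected_component (T : topologicalType) (A C : set T) : Prop :=
  exists2 x : T, A x & C = connected_component A x.

(* Main.v *)
Require Import Defs.
From mathcomp Require Import all_boot all_order all_algebra.
From mathcomp Require Import complex.
From mathcomp Require Import ring lra zify.
From mathcomp Require Import all_classical all_reals all_analysis.
Import numFieldNormedType.Exports.
Import Order.TTheory GRing.Theory Num.Theory.

Set Implicit Arguments.
Unset Strict Implicit.
Unset Printing Implicit Defensive.

Local Open Scope classical_set_scope.
Local Open Scope quotient_scope.
Local Open Scope ring_scope.

(** Why the theorem is true.

    _Rotations._ An element of PSL(2, R) has [theta] equal to [a] in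
    (0, 2 pi) exactly when it is a rotation of angle [a] of the half-plane
    ([thetaP]). Of the two matrices over it, the one with positive lower left
    entry, [norm_mx g], is in [ell (pi - a / 2)]: it turns clockwise by twice
    the angle [b = pi - a / 2]. With [b i = pi - alpha i / 2], the hypothesis
    on the sum of [alpha] says that the sum of the [b i] is less than [pi].

    _The Euler class is a turn count._ A matrix of [ell b] lifts to a map
    [cw_lift] of the universal cover of the boundary that moves each point
    clockwise by less than a turn, with translation number [- 2 b]. The
    composite of these lifts over all [n] generators is [x |-> x + 2 pi k] for
    some [k < 0], and the Euler class is [n + k] ([euler_lift]). So a
    super-maximal representation is one for which the composite makes exactly
    one turn. Then the partial composites make less than one turn from every
    starting point, so the partial products [T_j = B_j ... B_0] of the matrices
    of the generators fix no line: they are again clockwise rotations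
    ([partial_elliptic]). Conversely, if every proper partial product has a
    positive lower left entry, an orbit cannot make a second turn
    ([one_turn]). Super-maximality thus becomes a condition on matrices
    ([super_maximalP]).

    _Chains of triangles._ If [B], [T] and [B T] are clockwise rotations in
    [ell b], [ell c] and [ell t], their centres form a hyperbolic triangle with
    angles [b], [c] and [pi - t], whose defect [t - b - c] is nonnegative
    ([ell_triangle]). A super-maximal representation is therefore a chain of
    [n - 2] triangles, with nonnegative defects of sum [pi - sum b i]. Up to
    conjugation it is determined by these defects and by the direction in
    which each new vertex is seen ([conj_chain_hom]), and any such defects and
    directions occur ([super_maximal_chain_hom]). So the super-maximal classes
    are the image of the product of a simplex and a cube under a continuous
    map ([RepSM_chain]). This product is convex and compact, and it is
    non-empty because the sum of the [b i] is less than [pi]; hence the image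
    is non-empty, compact and connected.

    _Isolation._ Among the representations with the given angles,
    super-maximality is an open condition, being a finite set of strict
    inequalities. It is also closed: the triangle inequality keeps the angles
    of the partial products in a compact part of (0, pi), so that they cannot
    become parabolic in a limit ([super_maximal_tr_bound],
    [super_maximal_locally_constant]). The projection to conjugacy classes
    is an open map, so the super-maximal classes are open and closed in
    [Rep alpha] ([RepSM_component]). *)

(** * Continuity of real functions at a point *)

Section RealContinuity.
Variables (R : realType) (T : topologicalType).
Implicit Types (f g : T -> R) (x : T).

Lemma ct_cst x (a : R) : {for x, continuous (fun=> a)}.
Proof. exact: cvg_cst. Qed.

Lemma ctN x f : {for x, continuous f} -> {for x, continuous (fun z => - f z)}.
Proof. by move=> cf; apply: (@continuousN _ R^o). Qed.

Lemma ctD x f g : {for x, continuous f} -> {for x, continuous g} ->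
  {for x, continuous (fun z => f z + g z)}.
Proof. by move=> cf cg; apply: (@continuousD _ R^o _ f g). Qed.

Lemma ctB x f g : {for x, continuous f} -> {for x, continuous g} ->
  {for x, continuous (fun z => f z - g z)}.
Proof. by move=> cf cg; apply: (@continuousB _ R^o _ f g). Qed.

Lemma ctM x f g : {for x, continuous f} -> {for x, continuous g} ->
  {for x, continuous (fun z => f z * g z)}.
Proof. by move=> cf cg; apply: (@continuousM _ _ f g). Qed.

Lemma ctV x f : f x != 0 -> {for x, continuous f} ->
  {for x, continuous (fun z => (f z)^-1)}.
Proof. exact: continuousV. Qed.

Lemma ct_div x f g : g x != 0 -> {for x, continuous f} ->
  {for x, continuous g} -> {for x, continuous (fun z => f z / g z)}.
Proof. by move=> g0 cf cg; apply: ctM => //; apply: ctV. Qed.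

Lemma ct_sqr x f : {for x, continuous f} ->
  {for x, continuous (fun z => f z ^+ 2)}.
Proof. by move=> cf; exact: (ctM cf cf). Qed.

Lemma ct_comp x f (h : R -> R) : {for x, continuous f} ->
  {for f x, continuous h} -> {for x, continuous (fun z => h (f z))}.
Proof. by move=> cf ch; apply: (continuous_comp cf). Qed.

Lemma near_gt x f (a : R) : {for x, continuous f} -> a < f x ->
  \forall y \near x, a < f y.
Proof. by move=> cf ax; exact: (@cvgr_gt R T (nbhs x) _ f (f x) cf a ax). Qed.

Lemma near_lt x f (a : R) : {for x, continuous f} -> f x < a ->
  \forall y \near x, f y < a.
Proof. by move=> cf ax; exact: (@cvgr_lt R T (nbhs x) _ f (f x) cf a ax). Qed.

End RealContinuity.

(** * Two-by-two matrices *)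

Section Matrices2.
Variable R : comNzRingType.
Implicit Types A B M : 'M[R]_2.

Lemma ord2P (i : 'I_2) : i = 0 \/ i = 1.
Proof. by case: i => [[|[|k]]] // ki; [left|right]; apply: val_inj. Qed.

Lemma sum2E (V : nmodType) (F : 'I_2 -> V) : \sum_(i < 2) F i = F 0 + F 1.
Proof.
rewrite big_ord_recl big_ord1; congr (_ + F _); exact: val_inj.
Qed.

Lemma mulmx2E A (n : nat) (B : 'M[R]_(2, n)) i j :
  (A *m B) i j = A i 0 * B 0 j + A i 1 * B 1 j.
Proof. by rewrite mxE sum2E. Qed.

Lemma mxtrace2 M : \tr M = M 0 0 + M 1 1.
Proof. by rewrite /mxtrace sum2E. Qed.

Lemma det2 M : \det M = M 0 0 * M 1 1 - M 0 1 * M 1 0.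
Proof.
rewrite (expand_det_row M 0) sum2E /cofactor !det_mx11 !mxE /=.
have -> : lift 0 0 = 1 :> 'I_2 by exact: val_inj.
have -> : lift 1 0 = 0 :> 'I_2 by exact: val_inj.
by rewrite /= addn0 add0n expr0 expr1 mul1r; ring.
Qed.

Lemma mx2P A B : A 0 0 = B 0 0 -> A 0 1 = B 0 1 -> A 1 0 = B 1 0 ->
  A 1 1 = B 1 1 -> A = B.
Proof.
by move=> e00 e01 e10 e11; apply/matrixP => i j;
  case: (ord2P i) => ->; case: (ord2P j) => ->.
Qed.

Definition mx2 (a b c d : R) : 'M[R]_2 :=
  \matrix_(i, j) if i == 0 then (if j == 0 then a else b)
                 else (if j == 0 then c else d).

Lemma mx2E a b c d :
  (mx2 a b c d 0 0 = a) * (mx2 a b c d 0 1 = b) *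
  (mx2 a b c d 1 0 = c) * (mx2 a b c d 1 1 = d).
Proof. by rewrite !mxE. Qed.

(** The adjugate: the inverse of a matrix of determinant 1. *)
Definition adj2 M : 'M[R]_2 := mx2 (M 1 1) (- M 0 1) (- M 1 0) (M 0 0).

Lemma mul_adj2 M : \det M = 1 -> M *m adj2 M = 1%:M.
Proof.
by rewrite det2 => dM; apply: mx2P; rewrite mulmx2E !mx2E !mxE /= -?dM; ring.
Qed.

Lemma adj2_mul M : \det M = 1 -> adj2 M *m M = 1%:M.
Proof.
by rewrite det2 => dM; apply: mx2P; rewrite mulmx2E !mx2E !mxE /= -?dM; ring.
Qed.

Lemma det_adj2 M : \det (adj2 M) = \det M.
Proof. by rewrite !det2 !mx2E; ring. Qed.

Lemma det2N M : \det (- M) = \det M.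
Proof. by rewrite !det2 !mxE; ring. Qed.

Lemma tr_adj2_mul A B : \tr (adj2 A *m B) = \tr A * \tr B - \tr (A *m B).
Proof. by rewrite !mxtrace2 !mulmx2E !mx2E; ring. Qed.

Lemma adj2_mulmx A B : adj2 (A *m B) = adj2 B *m adj2 A.
Proof. by apply: mx2P; rewrite ?mulmx2E !mx2E ?mulmx2E; ring. Qed.

Lemma adj2K : involutive adj2.
Proof. by move=> M; apply: mx2P; rewrite /adj2 !mx2E ?opprK. Qed.

Lemma adj2N M : adj2 (- M) = - adj2 M.
Proof. by apply: mx2P; rewrite /adj2 !mxE. Qed.

Lemma tr_conj2 A B : \det A = 1 -> \tr (adj2 A *m B *m A) = \tr B.
Proof. by move=> dA; rewrite mxtrace_mulC mulmxA mul_adj2// mul1mx. Qed.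

End Matrices2.

(** * Elliptic matrices *)

Section Elliptic.
Variable R : realType.
Implicit Types (A B M P T : 'M[R]_2) (b c t x : R).

(** For [0 < b < pi], the rotations of SL(2, R) about a point of the upper
    half-plane, of angle [- 2 b] there. The trace leaves the sense of the
    rotation open; the sign of the lower left entry fixes it, and so selects
    one of the two matrices over an element of PSL(2, R). *)
Definition ell b M : Prop := [/\ \det M = 1, 0 < M 1 0 & \tr M = 2 * cos b].

Lemma cos_le_inv x y : 0 <= x <= pi -> 0 <= y <= pi ->
  (cos x <= cos y) = (y <= x) :> bool.
Proof.
move=> x0 y0; rewrite !leNgt; congr negb.
by rewrite ltr_cos // in_itv.
Qed.

Lemma cos_piB x : cos (pi - x) = - cos x.
Proof. by rewrite cosB cospi sinpi mul0r addr0 mulN1r. Qed.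

Lemma sin_piB x : sin (pi - x) = sin x.
Proof. by rewrite sinB cospi sinpi mul0r sub0r mulN1r opprK. Qed.

Lemma ell_det b M : ell b M ->
  - M 0 1 * M 1 0 = sin b ^+ 2 + ((M 0 0 - M 1 1) / 2) ^+ 2.
Proof.
case=> dM _; rewrite mxtrace2 => tM; rewrite sin2cos2.
have -> : cos b = (M 0 0 + M 1 1) / 2 by lra.
move: dM; rewrite det2; lra.
Qed.

(** The form is the determinant of a vector [(x, y)] and its image. It is
    definite because [M], having no real eigenvalue, preserves no line. *)
Lemma ell_form_gt0 b M x y : 0 < b < pi -> ell b M -> (x != 0) || (y != 0) ->
  0 < M 1 0 * x ^+ 2 - (M 0 0 - M 1 1) * x * y - M 0 1 * y ^+ 2.
Proof.
move=> b0 eM xy; have sb := sin_gt0_pi b0; have dM := ell_det eM.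
case: eM => _ c0 _; rewrite -(pmulr_rgt0 _ c0).
rewrite [X in 0 < X](_ : _ = (sin b * y) ^+ 2 +
    (M 1 0 * x - (M 0 0 - M 1 1) / 2 * y) ^+ 2); last first.
  transitivity ((- M 0 1 * M 1 0) * y ^+ 2 - M 1 0 * (M 0 0 - M 1 1) * x * y +
     M 1 0 ^+ 2 * x ^+ 2); first by ring.
  by rewrite dM; field.
have sqr_pos (z : R) : z != 0 -> 0 < z ^+ 2.
  by move=> z0; rewrite lt_def sqr_ge0 sqrf_eq0 z0.
have [y0|y0] := eqVneq y 0; last first.
  by rewrite ltr_pwDl ?sqr_ge0// sqr_pos// mulf_neq0// lt0r_neq0.
move: xy; rewrite y0 eqxx orbF => x0.
rewrite !mulr0 expr0n /= add0r subr0.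
by apply: sqr_pos; rewrite mulf_neq0// lt0r_neq0.
Qed.

(** Hyperbolic trigonometry in disguise: the trace of a product of rotations
    is [2 (cos b cos t - ch d sin b sin t)] where [d] is the distance between
    their centres. *)
Lemma ell_tr_mul b t B P : 0 < b < pi -> 0 < t < pi -> ell b B -> ell t P ->
  \tr (B *m P) <= 2 * cos (b + t).
Proof.
move=> b0 t0 eB eP.
have sb := sin_gt0_pi b0; have st := sin_gt0_pi t0.
have dB := ell_det eB; have dP := ell_det eP.
case: eB => _ B0 tB; case: eP => _ P0 tP.
rewrite mxtrace2 !mulmx2E cosD; rewrite mxtrace2 in tB; rewrite mxtrace2 in tP.
set u := (B 0 0 - B 1 1) / 2 in dB; set v := (P 0 0 - P 1 1) / 2 in dP.
have -> : B 0 0 = cos b + u by rewrite /u; lra.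
have -> : B 1 1 = cos b - u by rewrite /u; lra.
have -> : P 0 0 = cos t + v by rewrite /v; lra.
have -> : P 1 1 = cos t - v by rewrite /v; lra.
clearbody u v.
have eB : B 0 1 = - (sin b ^+ 2 + u ^+ 2) / B 1 0.
  by rewrite -dB; field; rewrite gt_eqF.
have eP : P 0 1 = - (sin t ^+ 2 + v ^+ 2) / P 1 0.
  by rewrite -dP; field; rewrite gt_eqF.
rewrite eB eP {eB eP dB dP}.
move: (B 1 0) (P 1 0) B0 P0 => p q p0 q0.
rewrite -subr_ge0.
set e := (X in 0 <= X).
suff -> : e = ((u * q - v * p) ^+ 2 + (sin b * q - sin t * p) ^+ 2) / (p * q).
  by rewrite divr_ge0 ?addr_ge0 ?sqr_ge0// mulr_ge0// ltW.
by rewrite /e; field; rewrite !gt_eqF.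
Qed.

Lemma ell_tr_div b t B P : 0 < b < pi -> 0 < t < pi -> ell b B -> ell t P ->
  2 * cos (t - b) <= \tr (adj2 B *m P).
Proof.
move=> b0 t0 eB eP; have := ell_tr_mul b0 t0 eB eP.
rewrite tr_adj2_mul; case: eB => _ _ ->; case: eP => _ _ ->.
rewrite cosB cosD; lra.
Qed.

(** The angle defect of a hyperbolic triangle is nonnegative. The traces of
    [T = B^-1 (B T)] and [B = (B T) T^-1] give [c <= |t - b|] and
    [b <= |t - c|]; if [t - b] or [t - c] is nonnegative, this is the claim,
    and otherwise [c < b] and [b < c]. *)
Lemma ell_triangle b c t B T : 0 < b < pi -> 0 < c < pi -> 0 < t < pi ->
  ell b B -> ell c T -> ell t (B *m T) -> b + c <= t.
Proof.
move=> b0 c0 t0 eB eT eBT.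
have h1 : c <= `|t - b|.
  rewrite -cos_le_inv; last 2 first.
  - by rewrite normr_ge0 ler_norml; lra.
  - by lra.
  rewrite cos_norm; have := ell_tr_div b0 t0 eB eBT.
  have [dB _ _] := eB; case: eT => _ _ tT.
  by rewrite mulmxA adj2_mul// mul1mx tT; lra.
have h2 : b <= `|t - c|.
  rewrite -cos_le_inv; last 2 first.
  - by rewrite normr_ge0 ler_norml; lra.
  - by lra.
  rewrite cos_norm; have := ell_tr_div c0 t0 eT eBT.
  rewrite mxtrace_mulC; have [dT _ _] := eT; case: eB => _ _ tB.
  by rewrite -mulmxA mul_adj2// mulmx1 tB; lra.
have [tb|tb] := leP 0 (t - b); first by rewrite ger0_norm// in h1; lra.
have [tc|tc] := leP 0 (t - c); first by rewrite ger0_norm// in h2; lra.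
by rewrite ltr0_norm// in h1; rewrite ltr0_norm// in h2; lra.
Qed.

(** The inverse turns anticlockwise by twice [b], that is clockwise by twice
    [pi - b], after a full turn that the sign of the matrix records. *)
Lemma ell_adj b M : ell b M -> ell (pi - b) (- adj2 M).
Proof.
case=> dM M0 tM; split.
- by rewrite det2N det_adj2.
- by rewrite mxE mx2E opprK.
- rewrite mxtrace2 !mxE /= cos_piB.
  by move: tM; rewrite mxtrace2; lra.
Qed.

(** Conversely, when [b + c < pi], a product with elliptic trace turns
    clockwise: otherwise its opposite would, and the inverses, with angles
    [pi - b] and [pi - c], would violate the triangle inequality. *)
Lemma ell_mul b c t B T : 0 < b < pi -> 0 < c < pi -> 0 < t < pi ->
  b + c < pi -> ell b B -> ell c T -> \tr (B *m T) = 2 * cos t ->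
  ell t (B *m T).
Proof.
move=> b0 c0 t0 bc eB eT tBT.
have dBT : \det (B *m T) = 1.
  by case: eB eT => [dB _ _] [dT _ _]; rewrite det_mulmx dB dT mulr1.
split=> //; case: (ltrgtP 0 ((B *m T) 1 0)) => // s0; exfalso.
  have eN : ell (pi - t) (- (B *m T)).
    split; first by rewrite det2N.
      by rewrite mxE oppr_gt0.
    by rewrite raddfN /= tBT cos_piB; lra.
  have := ell_adj eN; rewrite adj2N opprK subKr adj2_mulmx.
  rewrite -[_ *m _]opprK -mulNmx -mulmxN => eM.
  have := ell_triangle (b := pi - c) (c := pi - b) (t := t) (B := - adj2 T)
    (T := - adj2 B) _ _ t0 (ell_adj eT) (ell_adj eB).
  move=> H; suff : pi - c + (pi - b) <= t by lra.
  by apply: H => //; lra.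
(* A triangular matrix of determinant 1 has real eigenvalues. *)
have st := sin_gt0_pi t0; move: dBT tBT; rewrite det2 mxtrace2 -s0.
move: ((B *m T) 0 0) ((B *m T) 1 1) => x y; rewrite mulr0 subr0 => xy tr.
have : sin t ^+ 2 = - ((x - y) / 2) ^+ 2.
  rewrite sin2cos2; have -> : cos t = (x + y) / 2 by lra.
  by lra.
by have := exprn_gt0 2 st; have := sqr_ge0 ((x - y) / 2); lra.
Qed.

End Elliptic.

(** * Rotations with a given centre *)

Section Rotations.
Variable R : realType.
Implicit Types (A B M P T : 'M[R]_2) (b c t x y X Y psi : R).

(** The matrix of [ell c] that fixes the point [x + i y]. *)
Definition rot_mx c x y : 'M[R]_2 :=
  mx2 (cos c + sin c * x / y) (- (sin c * (x ^+ 2 + y ^+ 2) / y))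
      (sin c / y) (cos c - sin c * x / y).

Definition centre_re M := (M 0 0 - M 1 1) / 2 / M 1 0.
Definition centre_im c M := sin c / M 1 0.

Lemma ell_rot_mx c x y : 0 < c < pi -> 0 < y -> ell c (rot_mx c x y).
Proof.
move=> c0 y0; have sc := sin_gt0_pi c0; split.
- by rewrite det2 !mx2E -(cos2Dsin2 c); field; rewrite gt_eqF.
- by rewrite mx2E divr_gt0.
- by rewrite mxtrace2 !mx2E; lra.
Qed.

Lemma centre_im_gt0 c M : 0 < c < pi -> ell c M -> 0 < centre_im c M.
Proof. by move=> c0 [_ M0 _]; rewrite divr_gt0// sin_gt0_pi. Qed.

Lemma ell_rotE c M : 0 < c < pi -> ell c M ->
  M = rot_mx c (centre_re M) (centre_im c M).
Proof.
move=> c0 eM; have sc := sin_gt0_pi c0; have dM := ell_det eM.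
case: eM => _ M0; rewrite mxtrace2 => tM; have M0' := lt0r_neq0 M0.
have sc' := lt0r_neq0 sc.
rewrite /centre_re /centre_im; apply: mx2P; rewrite !mx2E.
- transitivity (cos c + (M 0 0 - M 1 1) / 2); first by lra.
  by field; rewrite M0' sc'.
- apply: (mulIf M0'); apply: oppr_inj; rewrite -mulNr dM.
  by field; rewrite M0' sc'.
- by field; rewrite M0' sc'.
- transitivity (cos c - (M 0 0 - M 1 1) / 2); first by lra.
  by field; rewrite M0' sc'.
Qed.

(** The fraction is twice the hyperbolic cosine of the distance between the
    centres [x + i y] and [X + i Y]. *)
Lemma tr_rot_mul b X Y c x y : Y != 0 -> y != 0 ->
  \tr (rot_mx b X Y *m rot_mx c x y) = 2 * cos b * cos c -
  sin b * sin c * (((X - x) ^+ 2 + Y ^+ 2 + y ^+ 2) / (Y * y)).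
Proof.
move=> Y0 y0; rewrite mxtrace2 !mulmx2E !mx2E; field.
by rewrite Y0 y0.
Qed.

Lemma circle_param p m s : 0 <= s -> p ^+ 2 + m ^+ 2 = s ^+ 2 ->
  exists2 psi : R, 0 <= psi <= 2 * pi & p = s * cos psi /\ m = s * sin psi.
Proof.
have pi0 := pi_gt0 R.
move=> s0 pms; have [s00|sn0] := eqVneq s 0.
  exists 0; first by lra.
  move: pms; rewrite s00 expr0n /= => /eqP.
  rewrite paddr_eq0 ?sqr_ge0// !sqrf_eq0 => /andP[/eqP-> /eqP->].
  by rewrite !mul0r.
have sp : 0 < s by rewrite lt_def sn0.
set z := p / s; set w := m / s.
have zw : z ^+ 2 + w ^+ 2 = 1.
  rewrite /z /w !expr_div_n -mulrDl pms divff// expf_neq0//.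
have z1 : -1 <= z <= 1.
  by apply/andP; split; have := sqr_ge0 w; nra.
have cz : cos (acos z) = z by rewrite acosK// in_itv.
have sz : sin (acos z) = `|w|.
  by rewrite sin_acos// -sqrtr_sqr; congr Num.sqrt; lra.
have pE : p = s * z by rewrite /z mulrCA divff// mulr1.
have mE : m = s * w by rewrite /w mulrCA divff// mulr1.
have [w0|w0] := leP 0 w.
  exists (acos z); first by have := acos_ge0 z1; have := acos_lepi z1; lra.
  by rewrite cz sz ger0_norm.
exists (2 * pi - acos z).
  by have := acos_ge0 z1; have := acos_lepi z1; lra.
rewrite cosB sinB (_ : 2 * pi = pi *+ 2) ?mulr_natl// cos2pi sin2pi cz sz.
by rewrite ltr0_norm// pE mE; split; ring.
Qed.

(** The hyperbolic cosine of the side between the vertices of angles [b], [c]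
    in a triangle whose third angle is [pi - t]. *)
Definition cosh_side b c t := (cos b * cos c - cos t) / (sin b * sin c).

(** The rotation of angle [b] whose centre sees that of [T] at the distance
    prescribed by [t], in the direction [psi]. *)
Definition step T b c t psi : 'M[R]_2 :=
  let ch := cosh_side b c t in
  let sh := Num.sqrt (ch ^+ 2 - 1) in
  let v := ch + sh * sin psi in
  rot_mx b (centre_re T + centre_im c T * (sh * cos psi) / v)
           (centre_im c T / v).

Section Step.
Variables (b c t : R).
Hypotheses (b0 : 0 < b) (c0 : 0 < c) (tpi : t < pi) (bct : b + c <= t).

Let bpi : 0 < b < pi.
Proof. by move: b0 c0 tpi bct; lra. Qed.
Let cpi : 0 < c < pi.
Proof. by move: b0 c0 tpi bct; lra. Qed.
Let sb := sin_gt0_pi bpi.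
Let sc := sin_gt0_pi cpi.

Lemma cosh_side_ge1 : 1 <= cosh_side b c t.
Proof.
rewrite ler_pdivlMr ?mulr_gt0// mul1r.
have : cos t <= cos (b + c) by rewrite cos_le_inv //; move: b0 c0 tpi bct; lra.
by rewrite cosD; lra.
Qed.

Let sh := Num.sqrt (cosh_side b c t ^+ 2 - 1).

Let sh2 : sh ^+ 2 = cosh_side b c t ^+ 2 - 1.
Proof.
rewrite sqr_sqrtr// subr_ge0 -(expr1n _ 2) ler_pXn2r ?nnegrE ?cosh_side_ge1//.
exact: le_trans cosh_side_ge1.
Qed.

Lemma step_denom_gt0 psi :
  0 < cosh_side b c t + Num.sqrt (cosh_side b c t ^+ 2 - 1) * sin psi.
Proof.
have ch1 := cosh_side_ge1; rewrite -/sh.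
have lt_sh : sh < cosh_side b c t.
  rewrite -(ltr_pXn2r (n := 2))// ?nnegrE ?sqrtr_ge0 ?sh2 //; first by lra.
  by apply: le_trans ch1.
have := sin_geN1 psi; have : 0 <= sh by exact: sqrtr_ge0.
nra.
Qed.

Lemma ell_step T psi : ell c T -> ell b (step T b c t psi).
Proof.
move=> eT; apply: ell_rot_mx => //.
by rewrite divr_gt0 ?step_denom_gt0// centre_im_gt0.
Qed.

Lemma ell_step_mul T psi : ell c T -> ell t (step T b c t psi *m T).
Proof.
move=> eT; apply: (ell_mul bpi cpi) => //; [by move: b0 c0 tpi bct; lra|by move: tpi bct; lra|exact: ell_step|].
rewrite [X in _ *m X](ell_rotE cpi eT).
have v0 := step_denom_gt0 psi.
have y0 := centre_im_gt0 cpi eT.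
rewrite tr_rot_mul; [|exact/lt0r_neq0/divr_gt0|exact: lt0r_neq0].
move: (centre_re T) (centre_im c T) y0 v0 => x y y0.
rewrite -/sh; set v := _ + _ => v0.
have -> : (x + y * (sh * cos psi) / v - x) ^+ 2 + (y / v) ^+ 2 + y ^+ 2 =
   (sh ^+ 2 * (1 - sin psi ^+ 2) + 1 + v ^+ 2) * (y / v) ^+ 2.
  by rewrite -cos2sin2; field; rewrite gt_eqF.
have -> : sh ^+ 2 * (1 - sin psi ^+ 2) + 1 + v ^+ 2 = 2 * cosh_side b c t * v.
  by rewrite mulrBr mulr1 {1}sh2 /v; ring.
rewrite (_ : _ / _ = 2 * cosh_side b c t); last first.
  by field; rewrite !gt_eqF.
by rewrite /cosh_side; field; rewrite !gt_eqF.
Qed.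

(** The trace of [B T] prescribes the distance between the centres of [B] and
    [T], so the centre of [B] lies on a circle around that of [T]; [psi] is its
    position there. *)
Lemma step_onto T B : ell c T -> ell b B -> ell t (B *m T) ->
  exists2 psi, 0 <= psi <= 2 * pi & B = step T b c t psi.
Proof.
move=> eT eB [_ _]; have BE := ell_rotE bpi eB.
rewrite BE (ell_rotE cpi eT).
have Y0 := centre_im_gt0 bpi eB; have y0 := centre_im_gt0 cpi eT.
have yn0 := lt0r_neq0 y0; have Yn0 := lt0r_neq0 Y0.
rewrite tr_rot_mul // /step -(ell_rotE cpi eT) -/sh.
set X := centre_re B; set Y := centre_im b B.
set x := centre_re T; set y := centre_im c T => tr.
pose p := (X - x) / Y; pose v := y / Y; pose w := (p ^+ 2 + 1) / v.
have chE : cosh_side b c t = (v + w) / 2.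
  rewrite /cosh_side; apply: (mulIf (lt0r_neq0 (mulr_gt0 sb sc))).
  rewrite mulfVK ?lt0r_neq0 ?mulr_gt0//.
  have -> : cos t = cos b * cos c -
    sin b * sin c * (((X - x) ^+ 2 + Y ^+ 2 + y ^+ 2) / (Y * y)) / 2 by lra.
  by rewrite /w /v /p; field; rewrite yn0 Yn0.
have [|psi psi0 [pE mE]] := @circle_param p ((v - w) / 2) sh (sqrtr_ge0 _).
  by rewrite sh2 chE /w; field; rewrite /v mulf_neq0// invr_eq0.
exists psi => //; rewrite -pE -mE chE.
have -> : (v + w) / 2 + (v - w) / 2 = v by lra.
by congr rot_mx; rewrite /v /p; field; rewrite yn0 Yn0.
Qed.

End Step.
End Rotations.

(** * Chains of triangles *)

(** Products grow on the left because the rightmost factor of a composite acts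
    first. *)
Fixpoint rprod (T : Type) (op : T -> T -> T) (f : nat -> T) (j : nat) : T :=
  if j is k.+1 then op (f k.+1) (rprod op f k) else f 0%N.

Lemma eq_rprod (T : Type) (op : T -> T -> T) (f g : nat -> T) (j : nat) :
  (forall i, (i <= j)%N -> f i = g i) -> rprod op f j = rprod op g j.
Proof.
elim: j => [|j IHj] fg; first exact: fg.
by rewrite /= fg// IHj// => i ij; apply: fg; apply: leqW.
Qed.

Lemma rprod_pred (T : Type) (op : T -> T -> T) (f : nat -> T) (j : nat) :
  (0 < j)%N -> rprod op f j = op (f j) (rprod op f j.-1).
Proof. by case: j. Qed.

Section Chains.
Variable R : realType.
Implicit Types (b s psi t : nat -> R) (B : nat -> 'M[R]_2) (j p : nat).

Fixpoint angle b s j : R :=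
  if j is k.+1 then angle b s k + b k.+1 + s k.+1 else b 0%N.

Fixpoint chain_prod b s psi j : 'M[R]_2 :=
  if j is k.+1 then
    step (chain_prod b s psi k) (b k.+1) (angle b s k) (angle b s k.+1)
         (psi k.+1) *m chain_prod b s psi k
  else rot_mx (b 0%N) 0 1.

(** The factors of [chain_prod]: rotations of angles [b j] whose successive
    products have the angles [angle b s j]. Consecutive centres form a chain of
    triangles, with angle defects [s] and directions [psi]. *)
Definition chain b s psi j : 'M[R]_2 :=
  if j is k.+1 then
    step (chain_prod b s psi k) (b k.+1) (angle b s k) (angle b s k.+1)
         (psi k.+1)
  else rot_mx (b 0%N) 0 1.

(** The chain followed by the factor that makes the whole product [-1]. *)
Definition closed_chain b s psi p j : 'M[R]_2 :=
  if (j <= p)%N then chain b s psi j else - adj2 (chain_prod b s psi p).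

Lemma rprod_chain b s psi j :
  rprod mulmx (chain b s psi) j = chain_prod b s psi j.
Proof. by elim: j => //= j ->. Qed.

Lemma angle_le b s p i j : (forall k, (k <= p)%N -> 0 < b k) ->
  (forall k, (0 < k <= p)%N -> 0 <= s k) -> (i <= j <= p)%N ->
  angle b s i <= angle b s j.
Proof.
move=> b0 s0; elim: j => [|j IHj]; first by rewrite leqn0 => /andP[/eqP->].
move=> /andP[]; rewrite leq_eqVlt => /orP[/eqP->//|ij jp].
apply: le_trans (IHj _) _; first by rewrite -ltnS ij ltnW.
by rewrite /= -addrA lerDl addr_ge0// ?s0// ltW// b0.
Qed.

Section ChainParameters.
Variables (b s : nat -> R) (p : nat).
Hypothesis b0 : forall k, (k <= p)%N -> 0 < b k.
Hypothesis s0 : forall k, (0 < k <= p)%N -> 0 <= s k.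
Hypothesis angle_pi : angle b s p < pi.

Lemma angle_gt0 j : (j <= p)%N -> 0 < angle b s j.
Proof.
move=> jp; apply: (@lt_le_trans _ _ (angle b s 0)); first exact: b0.
exact: (angle_le b0 s0).
Qed.

Lemma angle_ltpi j : (j <= p)%N -> angle b s j < pi.
Proof.
move=> jp; apply: le_lt_trans angle_pi.
by apply: (angle_le b0 s0); rewrite jp leqnn.
Qed.

Lemma angle_step j : (j < p)%N -> b j.+1 + angle b s j <= angle b s j.+1.
Proof. by move=> jp; rewrite /= [b _ + _]addrC lerDl s0. Qed.

Lemma ell_chain psi j : (j <= p)%N ->
  ell (b j) (chain b s psi j) /\ ell (angle b s j) (chain_prod b s psi j).
Proof.
elim: j => [|j IHj] jp.
  have h : 0 < b 0%N < pi by rewrite b0//=; exact: (@angle_ltpi 0).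
  by split; apply: ell_rot_mx.
have [|_ eT] := IHj; first exact: ltnW.
have bj := b0 jp; have aj := angle_gt0 (ltnW jp).
split; first exact: (ell_step bj aj (angle_ltpi jp) (angle_step jp)).
exact: (ell_step_mul bj aj (angle_ltpi jp) (angle_step jp)).
Qed.

Lemma ell_closed_chain psi j : angle b s p = pi - b p.+1 -> (j <= p.+1)%N ->
  ell (b j) (closed_chain b s psi p j).
Proof.
move=> ap; rewrite leq_eqVlt /closed_chain ltnS => /orP[/eqP->|jp].
  rewrite ltnn -(subKr pi (b p.+1)) -ap; apply: ell_adj.
  by have [] := ell_chain psi (leqnn p).
by rewrite jp; have [] := ell_chain psi jp.
Qed.

Lemma rprod_closed_chain psi j : (j <= p)%N ->
  rprod mulmx (closed_chain b s psi p) j = chain_prod b s psi j.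
Proof.
move=> jp; rewrite -rprod_chain; apply: eq_rprod => i ij.
by rewrite /closed_chain (leq_trans ij jp).
Qed.

Lemma rprod_closed_chain_last psi :
  rprod mulmx (closed_chain b s psi p) p.+1 = - 1%:M.
Proof.
rewrite /= rprod_closed_chain// /closed_chain ltnn mulNmx adj2_mul//.
by have [_ []] := ell_chain psi (leqnn p).
Qed.

End ChainParameters.

(** The defects are forced by the angles, and nonnegative by the triangle
    inequality; the directions come from [step_onto], one triangle at a
    time. *)
Lemma chain_onto b t B p :
  (forall j, (j <= p)%N -> 0 < b j < pi /\ ell (b j) (B j)) ->
  (forall j, (j <= p)%N -> 0 < t j < pi /\ ell (t j) (rprod mulmx B j)) ->
  B 0%N = rot_mx (b 0%N) 0 1 ->
  exists s psi, [/\ forall j, 0 <= psi j <= 2 * pi,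
    forall j, (0 < j <= p)%N -> 0 <= s j,
    angle b s p = t p &
    forall j, (j <= p)%N ->
      chain b s psi j = B j /\ chain_prod b s psi j = rprod mulmx B j].
Proof.
move=> eB eT B0.
have pi0 := pi_gt0 R.
pose s j := if j is k.+1 then t k.+1 - t k - b k.+1 else 0.
have t0 : t 0%N = b 0%N.
  have [tp [_ _ tr]] := eT 0%N (leq0n _).
  have [bp [_ _ tr']] := eB 0%N (leq0n _).
  apply: cos_inj; rewrite ?in_itv /=; [lra|lra|].
  by move: tr; rewrite /= tr'; lra.
have aE j : angle b s j = t j by elim: j => //= j ->; rewrite addrACA subrr; lra.
have ht j : (j < p)%N -> b j.+1 + t j <= t j.+1.
  move=> jp; have [bp eBj] := eB _ jp.
  have [tp eTj] := eT _ (ltnW jp); have [tp' eTj'] := eT _ jp.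
  exact: ell_triangle eTj'.
have /choice[psi psiP] : forall j, exists x, 0 <= x <= 2 * pi /\
    ((0 < j <= p)%N -> B j = step (rprod mulmx B j.-1) (b j) (t j.-1) (t j) x).
  case=> [|j]; first by exists 0; split=> //; lra.
  have [jp|jp] := leqP j.+1 p; last by exists 0; split=> //; lra.
  have [bp eBj] := eB _ jp.
  have [tp eTj] := eT _ (ltnW jp); have [tp' eTj'] := eT _ jp.
  have [b_gt0 _] := andP bp; have [t_gt0 _] := andP tp; have [_ t_lt] := andP tp'.
  have [x x0 xE] := step_onto b_gt0 t_gt0 t_lt (ht _ jp) eTj eBj eTj'.
  by exists x.
exists s, psi; split=> [j|[//|j] jp||].
- by have [] := psiP j.
- by rewrite /s; have := ht _ jp; lra.
- exact: aE.
elim=> [|j IHj] jp; first by rewrite /= B0.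
have [_ h] := IHj (ltnW jp).
have cE : chain b s psi j.+1 = B j.+1.
  by rewrite /chain h !aE; have [_ ->] := psiP j.+1.
split=> //.
rewrite -[LHS]/(chain b s psi j.+1 *m chain_prod b s psi j).
by rewrite cE h.
Qed.

End Chains.

(** * The angle function *)

Lemma is_derive_homography (K : numFieldType) (a b c d : K) (z : K^o) :
  c * z + d != 0 ->
  is_derive z 1 (fun z : K^o => (a * z + b) / (c * z + d) : K^o)
    ((a * d - b * c) / (c * z + d) ^+ 2).
Proof.
move=> h0.
have dA (u v : K) : is_derive z 1 (fun z : K^o => u * z + v : K^o) u.
  have h := is_deriveD (is_deriveZ u (is_derive_id z (1 : K^o)))
                       (is_derive_cst (v : K^o) z (1 : K^o)).
  by apply: is_derive_eq h _; rewrite addr0 /GRing.scale /= mulr1.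
have [dc dcE] := dA c d.
have dV : is_derive z 1 (fun z : K^o => (c * z + d)^-1 : K^o)
    (- (c / (c * z + d) ^+ 2)).
  apply: DeriveDef; first exact: derivableV.
  by rewrite deriveV // dcE /GRing.scale /= mulNr mulrC.
have h := is_deriveM (dA a b) dV.
by apply: is_derive_eq h _; rewrite /GRing.scale /=; field.
Qed.

Section NormalizedMatrix.
Variable R : realType.
Implicit Types (g h : PSL2 R) (M : 'M[R]_2) (b t x y : R).

Local Notation C := (R[i]^o)%type.

Lemma det_PSL2_mx g : \det (PSL2_mx g) = 1.
Proof. exact: det_SL2. Qed.

(** Of the two matrices over [g], the one with positive lower left entry; it is
    zero when [g] fixes infinity, which no rotation does. *)
Definition norm_mx g : 'M[R]_2 := Num.sg (PSL2_mx g 1 0) *: PSL2_mx g.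

Lemma PSL2_mx_pi (A : SL2 R) :
  PSL2_mx (\pi_(PSL2 R) A) = SL2_mx A \/ PSL2_mx (\pi_(PSL2 R) A) = - SL2_mx A.
Proof. by have /orP[/eqP|/eqP] := repr_pi_pm A; [left|right]. Qed.

Lemma scale_of_sign (A B : 'M[R]_2) : A = B \/ A = - B ->
  exists2 e : R, e != 0 & A = e *: B.
Proof.
by case=> ->; [exists 1|exists (-1)];
  rewrite ?oppr_eq0 ?oner_neq0 ?scale1r ?scaleN1r.
Qed.

Lemma norm_mx_of_sign g M : 0 < M 1 0 ->
  PSL2_mx g = M \/ PSL2_mx g = - M -> norm_mx g = M.
Proof.
move=> M0; rewrite /norm_mx => -[->|->]; first by rewrite gtr0_sg// scale1r.
by rewrite mxE ltr0_sg ?oppr_lt0// scaleN1r opprK.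
Qed.

Lemma norm_mx_pi (A : SL2 R) : 0 < SL2_mx A 1 0 ->
  norm_mx (\pi_(PSL2 R) A) = SL2_mx A.
Proof. by move=> A0; exact: norm_mx_of_sign A0 (PSL2_mx_pi A). Qed.

Lemma norm_mx10 g : norm_mx g 1 0 = `|PSL2_mx g 1 0|.
Proof. by rewrite mxE -normrEsg. Qed.

Lemma norm_mx_sign g : PSL2_mx g 1 0 != 0 ->
  norm_mx g = PSL2_mx g \/ norm_mx g = - PSL2_mx g.
Proof.
rewrite /norm_mx => g0; case: sgrP g0 => //; rewrite ?scale1r ?scaleN1r; first by left.
by right.
Qed.

Lemma det_norm_mx g : PSL2_mx g 1 0 != 0 -> \det (norm_mx g) = 1.
Proof.
by move=> /norm_mx_sign[] ->; rewrite ?det2N det_PSL2_mx.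
Qed.

Lemma pi_norm_mx g (A : SL2 R) : PSL2_mx g 1 0 != 0 ->
  SL2_mx A = norm_mx g -> \pi_(PSL2 R) A = g.
Proof.
move=> g0 Ag; rewrite -[RHS]reprK; apply/pi_pm_eq; rewrite /pm_eq Ag.
by have [->|->] := norm_mx_sign g0; rewrite eqxx ?orbT.
Qed.

Lemma ell_norm_mx_neq0 b g : ell b (norm_mx g) -> PSL2_mx g 1 0 != 0.
Proof. by case=> _; rewrite norm_mx10 normr_gt0. Qed.

Lemma ell_inj b c M : 0 < b < pi -> 0 < c < pi -> ell b M -> ell c M -> b = c.
Proof.
move=> b0 c0 [_ _ tb] [_ _]; rewrite tb => tc.
by apply: cos_inj; rewrite ?in_itv /=; lra.
Qed.

Lemma ell_acos M : \det M = 1 -> 0 < M 1 0 -> `|\tr M| < 2 ->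
  exists2 b : R, 0 < b < pi & ell b M.
Proof.
rewrite ltr_norml => dM M0 tM.
have t1 : -1 < \tr M / 2 < 1 by lra.
exists (acos (\tr M / 2)).
  by rewrite acos_gt0 ?acos_ltpi//; lra.
by split=> //; rewrite acosK ?in_itv /=; lra.
Qed.

Lemma tr_pi_norm_mx g : PSL2_mx g 1 0 != 0 ->
  `|\tr (norm_mx g)| = `|\tr (PSL2_mx g)|.
Proof. by move=> /norm_mx_sign[] ->; rewrite ?raddfN ?normrN. Qed.

Lemma neq0_of_tr_lt2 M : \det M = 1 -> `|\tr M| < 2 -> M 1 0 != 0.
Proof.
rewrite det2 mxtrace2 ltr_norml; case: eqP => // ->; rewrite mulr0 subr0.
move: (M 0 0) (M 1 1) => a d ad; have := sqr_ge0 (a - d).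
nra.
Qed.

Lemma ell_of_tr_lt2 g : `|\tr (PSL2_mx g)| < 2 ->
  exists2 b : R, 0 < b < pi & ell b (norm_mx g).
Proof.
move=> tg; have g0 := neq0_of_tr_lt2 (det_PSL2_mx g) tg.
apply: ell_acos; rewrite ?det_norm_mx// ?norm_mx10 ?normr_gt0//.
by rewrite tr_pi_norm_mx.
Qed.

Lemma tr_lt2_of_ell b g : 0 < b < pi -> ell b (norm_mx g) ->
  `|\tr (PSL2_mx g)| < 2.
Proof.
move=> b0 eg; rewrite -tr_pi_norm_mx ?(ell_norm_mx_neq0 eg)//.
case: eg => _ _ ->; have := sin_gt0_pi b0; have := cos2Dsin2 b.
rewrite ltr_norml; nra.
Qed.

Lemma moebius_denom_neq0 g x y : 0 < y ->
  (((PSL2_mx g 1 0 * x + PSL2_mx g 1 1) +i* (PSL2_mx g 1 0 * y)) != 0)%C.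
Proof.
move=> y0; set M := PSL2_mx g; rewrite eq_complex /=; apply/negP => /andP[/eqP e1 /eqP e2].
have c0 : M 1 0 = 0 by apply/eqP; have /eqP := e2; rewrite mulf_eq0 (gt_eqF y0) orbF.
move: e1; rewrite c0 mul0r add0r => d0.
have := det_PSL2_mx g; rewrite -/M det2 c0 d0 !mulr0 subr0 => /eqP.
by rewrite eq_sym oner_eq0.
Qed.

Lemma derive_moebius g x y : 0 < y ->
  let M := PSL2_mx g in
  is_derive ((x +i* y)%C : C) 1 (moebius g)
    (1 / ((M 1 0 * x + M 1 1) +i* (M 1 0 * y)) ^+ 2)%C.
Proof.
move=> y0 M.
have wE : ((M 1 0)%:C * (x +i* y) + (M 1 1)%:C =
          (M 1 0 * x + M 1 1) +i* (M 1 0 * y))%C.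
  by apply/eqP; rewrite eq_complex /= !mul0r !subr0 !addr0 !eqxx.
have h0 : ((M 1 0)%:C * (x +i* y) + (M 1 1)%:C != 0)%C.
  by rewrite wE; exact: moebius_denom_neq0.
have h := is_derive_homography ((M 0 0)%:C)%C ((M 0 1)%:C)%C h0.
apply: is_derive_eq h _; rewrite wE; congr (_ / _).
rewrite -!rmorphM -rmorphB /=.
by have := det_PSL2_mx g; rewrite det2 => ->.
Qed.

Lemma moebius_fixP g x y : 0 < y ->
  let M := PSL2_mx g in
  moebius g (x +i* y)%C = (x +i* y)%C <->
  M 0 0 * x + M 0 1 = x * (M 1 0 * x + M 1 1) - y * (M 1 0 * y) /\
  M 0 0 * y = x * (M 1 0 * y) + y * (M 1 0 * x + M 1 1).
Proof.
move=> y0 M.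
have wE : ((M 1 0)%:C * (x +i* y) + (M 1 1)%:C =
          (M 1 0 * x + M 1 1) +i* (M 1 0 * y))%C.
  by apply/eqP; rewrite eq_complex /= !mul0r !subr0 !addr0 !eqxx.
have vE : ((M 0 0)%:C * (x +i* y) + (M 0 1)%:C =
          (M 0 0 * x + M 0 1) +i* (M 0 0 * y))%C.
  by apply/eqP; rewrite eq_complex /= !mul0r !subr0 !addr0 !eqxx.
have h0 := moebius_denom_neq0 g x y0.
rewrite /moebius -/M wE vE; split.
  move=> /(canRL (mulfVK h0)) /eqP.
  by rewrite eq_complex /= => /andP[/eqP-> /eqP->].
move=> [e1 e2]; apply: (canLR (mulfK h0)); apply/eqP.
by rewrite eq_complex /= e1 e2 !eqxx.
Qed.

Lemma cos_half t : cos t = cos (t / 2) ^+ 2 - sin (t / 2) ^+ 2.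
Proof. by rewrite [in LHS](splitr t) cosD -!expr2. Qed.

Lemma sin_half t : sin t = 2 * (sin (t / 2) * cos (t / 2)).
Proof. by rewrite [in LHS](splitr t) sinD [cos _ * _]mulrC -mulr2n mulr_natl. Qed.

(** At a fixed point [z], the derivative is [(c z + d)^-2], and the real part
    of [c z + d] is half the trace. *)
Lemma ell_of_rotation g t : 0 < t < 2 * pi -> has_rotation_angle g t ->
  ell (pi - t / 2) (norm_mx g).
Proof.
move=> t0 [[x y] [y0 fz D]]; rewrite /upper_half_plane /= in y0.
have [_ f2] := (moebius_fixP g x y0).1 fz.
have D' := derive_moebius g x y0.
have := @derive_val _ _ _ _ _ _ _ D; rewrite (@derive_val _ _ _ _ _ _ _ D').
have := moebius_denom_neq0 g x y0; move: f2; rewrite {D D' fz}.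
have dM := det_PSL2_mx g.
have sv : 0 < sin (t / 2) by apply: sin_gt0_pi; lra.
set w := (_ +i* _)%C => f2 w0 /(canRL (mulfVK _)) -/(_ (expf_neq0 2 w0)) /eqP.
rewrite expr2 /w eq_complex /= (cos_half t) (sin_half t).
move: f2; set p := _ + PSL2_mx g 1 1; set q := PSL2_mx g 1 0 * y => f2.
move=> /andP[/eqP E1 /eqP E2].
have := cos2Dsin2 (t / 2); move: E1 E2 sv.
set u := cos (t / 2); set v := sin (t / 2) => E1 E2 v0 uv.
(* [X + i Y] is [(c z + d) e^(i t / 2)], whose square is 1. *)
pose X := p * u - q * v; pose Y := p * v + q * u.
have XY : X ^+ 2 - Y ^+ 2 = 1 by rewrite [RHS]E1 /X /Y; ring.
have XY0 : X * Y = 0.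
  by rewrite -[RHS](mulr0 2^-1) E2 /X /Y; field.
have Y0 : Y = 0.
  apply/eqP; move/eqP: XY0; rewrite mulf_eq0 => /orP[/eqP X0|//].
  by move: XY; rewrite X0; have := sqr_ge0 Y; lra.
have X1 : X * X = 1 by rewrite Y0 in XY; lra.
have pE : p = X * u.
  by rewrite -[LHS]mulr1 -uv -[RHS]addr0 -(mul0r v) -Y0 /X /Y; ring.
have qE : q = - (X * v).
  by rewrite -[LHS]mulr1 -uv -[RHS]addr0 -(mul0r u) -Y0 /X /Y; ring.
have trE : \tr (PSL2_mx g) = 2 * (X * u).
  apply: (mulIf (lt0r_neq0 y0)); rewrite mxtrace2 mulrDl f2.
  by rewrite -pE /p /q; ring.
have c0 : PSL2_mx g 1 0 = - X * v / y.
  by apply: (mulIf (lt0r_neq0 y0)); rewrite mulfVK ?lt0r_neq0// mulNr -qE.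
have X0 : X != 0 by apply: contra_eqN X1 => /eqP->; rewrite mul0r eq_sym oner_eq0.
have sgc : Num.sg (PSL2_mx g 1 0) = - X.
  rewrite c0 !sgrM [Num.sg y^-1]gtr0_sg ?invr_gt0// [Num.sg v]gtr0_sg// !mulr1.
  have : (X - 1) * (X + 1) = 0 by move: X1; lra.
  move=> /eqP; rewrite mulf_eq0 subr_eq0 addr_eq0 => /orP[] /eqP->.
    by rewrite sgrN sgr1.
  by rewrite opprK sgr1.
have g0 : PSL2_mx g 1 0 != 0 by rewrite -sgr_eq0 sgc oppr_eq0.
split; first exact: det_norm_mx.
  by rewrite norm_mx10 normr_gt0.
rewrite /norm_mx sgc mxtraceZ trE cos_piB -/u.
by transitivity (- (X * X) * (2 * u)); [ring|rewrite X1; ring].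
Qed.

Lemma rotation_of_ell g t : 0 < t < 2 * pi -> ell (pi - t / 2) (norm_mx g) ->
  has_rotation_angle g t.
Proof.
move=> t0 eg; have g0 := ell_norm_mx_neq0 eg.
have b0 : 0 < pi - t / 2 < pi by lra.
set N := norm_mx g in eg; have y0 := centre_im_gt0 b0 eg.
have NE := ell_rotE b0 eg.
move: y0 NE; set x := centre_re N; set y := centre_im _ N => y0 NE.
exists (x +i* y)%C.
have : exists2 e : R, e * e = 1 & PSL2_mx g = e *: N.
  have [NM|NM] := norm_mx_sign g0; rewrite /N NM.
    by exists 1; rewrite ?mul1r ?scale1r.
  by exists (-1); rewrite ?mulrNN ?mulr1// scaleN1r opprK.
move=> [e e1 ME]; split=> //.
  apply/moebius_fixP => //; rewrite ME NE !mxE /=; move: y0 => /lt0r_neq0 yn0.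
  by split; field.
have h := derive_moebius g x y0; apply: is_derive_eq h _.
set w := (_ +i* _)%C.
have wE : w = ((e * cos (pi - t / 2)) +i* (e * sin (pi - t / 2)))%C.
  rewrite /w ME NE !mxE /=; move: y0 => /lt0r_neq0 yn0.
  by apply/eqP; rewrite eq_complex /=; apply/andP; split; apply/eqP; field.
have w0 := moebius_denom_neq0 g x y0.
apply: (canLR (mulfK (expf_neq0 2 w0))).
rewrite -/w wE cos_piB sin_piB (cos_half t) (sin_half t) expr2; apply/eqP.
rewrite eq_complex /=; have := cos2Dsin2 (t / 2); move: e1.
move: (cos (t / 2)) (sin (t / 2)) => u v e1 uv.
apply/andP; split; apply/eqP; last by ring.
transitivity (e * e * (u ^+ 2 + v ^+ 2) ^+ 2); first by rewrite e1 uv; ring.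
by ring.
Qed.

Lemma PSL2_mxM g h :
  PSL2_mx (g * h)%g = PSL2_mx g *m PSL2_mx h \/
  PSL2_mx (g * h)%g = - (PSL2_mx g *m PSL2_mx h).
Proof. exact: PSL2_mx_pi. Qed.

Lemma invmx_adj2 M : \det M = 1 -> invmx M = adj2 M.
Proof.
move=> dM; have uM : M \in unitmx by rewrite unitmxE dM unitr1.
by rewrite -[LHS]mulmx1 -(mul_adj2 dM) mulmxA mulVmx// mul1mx.
Qed.

Lemma PSL2_mxV g :
  PSL2_mx g^-1%g = adj2 (PSL2_mx g) \/ PSL2_mx g^-1%g = - adj2 (PSL2_mx g).
Proof.
by rewrite -(invmx_adj2 (det_PSL2_mx g)); exact: (PSL2_mx_pi (SL2_inv _)).
Qed.

Lemma PSL2_mx1 : PSL2_mx (1%g : PSL2 R) = 1%:M \/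
                 PSL2_mx (1%g : PSL2 R) = - 1%:M.
Proof. exact: PSL2_mx_pi. Qed.

Lemma normr_tr_conj g h : `|\tr (PSL2_mx (g ^ h)%g)| = `|\tr (PSL2_mx g)|.
Proof.
rewrite conjgE mulgA; have [->|->] := PSL2_mxM (h^-1 * g)%g h;
  rewrite ?raddfN ?normrN /= ; have [->|->] := PSL2_mxM h^-1%g g;
  rewrite ?mulNmx ?raddfN ?normrN /= ; have [->|->] := PSL2_mxV h;
  by rewrite ?mulNmx ?raddfN ?normrN /= tr_conj2 ?det_PSL2_mx.
Qed.

Lemma tr_unit_translation g : is_unit_translation g ->
  `|\tr (PSL2_mx g)| = 2.
Proof.
move=> tg; set M := PSL2_mx g.
have E y : 0 < y -> M 0 1 = M 1 1 - y * (M 1 0 * y) /\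
    M 0 0 * y = M 1 0 * y + y * M 1 1.
  move=> y0; have := tg (0 +i* y)%C y0; rewrite /moebius -/M.
  have h0 := moebius_denom_neq0 g 0 y0.
  have wE : ((M 1 0)%:C * (0 +i* y) + (M 1 1)%:C =
            (M 1 0 * 0 + M 1 1) +i* (M 1 0 * y))%C.
    by apply/eqP; rewrite eq_complex /= !mul0r !subr0 !addr0 !eqxx.
  rewrite wE => /(canRL (mulfVK h0)) /eqP.
  rewrite eq_complex /= => /andP[/eqP e1 /eqP e2].
  by split; [move: e1|move: e2]; rewrite -/M; lra.
have [e1 e2] := E 1 ltr01; have [e3 e4] := E 2 (ltr0n _ 2).
have c0 : M 1 0 = 0 by lra.
have da : M 1 1 = M 0 0 by lra.
have := det_PSL2_mx g; rewrite -/M det2 mxtrace2 c0 da => aa.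
have : (M 0 0 - 1) * (M 0 0 + 1) = 0 by lra.
move=> /eqP; rewrite mulf_eq0 subr_eq0 addr_eq0 => /orP[] /eqP->.
  by rewrite ger0_norm; lra.
by rewrite ler0_norm; lra.
Qed.

(** The range [0 < t < 2 pi] of [theta] is attained exactly at the rotations
    of angle [t]: the hyperbolic and parabolic elements and the identity have
    a trace of absolute value at least 2. *)
Lemma thetaP g t : 0 < t < 2 * pi ->
  theta g = t <-> ell (pi - t / 2) (norm_mx g).
Proof.
move=> t0; split=> [|eg]; last first.
  have b0 : 0 < pi - t / 2 < pi by lra.
  have tr2 := tr_lt2_of_ell b0 eg.
  rewrite /theta ifF; last first.
    apply/asboolP => -[|[h th]]; first by rewrite /hyperbolic => /lt_trans /(_ tr2); rewrite ltxx.
    by move: tr2; rewrite -(normr_tr_conj g h) tr_unit_translation// ltxx.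
  rewrite ifF; last first.
    apply/asboolP => -[[[_ tr2'] _]|g1]; first by rewrite tr2' ltxx in tr2.
    move: tr2; rewrite g1; have [->|->] := PSL2_mx1;
      by rewrite ?raddfN ?normrN /= mxtrace1 ger0_norm// ltxx.
  have [/andP[t'0 t'pi] /ell_of_rotation e'] :
      [set u | 0 < u < 2 * pi /\ has_rotation_angle g u]
      (get [set u | 0 < u < 2 * pi /\ has_rotation_angle g u]).
    by apply: getPex; exists t; split=> //; exact: rotation_of_ell.
  move: t'0 t'pi e'; set u := get _ => u0 upi /(_ _) e'.
  have {}e' := e' (introT andP (conj u0 upi)).
  suff : pi - u / 2 = pi - t / 2 by lra.
  by apply: ell_inj e' eg; lra.
have p0 := pi_gt0 R.
rewrite /theta; case: asboolP => [_ t00|nhyp]; first by move: t0; rewrite -t00 ltxx.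
case: asboolP => [_ tpi|npar]; first by move: t0; rewrite -tpi ltxx andbF.
move=> tE; apply: ell_of_rotation => //.
suff [u] : exists u, 0 < u < 2 * pi /\ has_rotation_angle g u.
  by rewrite -tE => hu; have [] := @getPex _ [set u | 0 < u < 2 * pi /\ has_rotation_angle g u] (ex_intro _ u hu).
have [tr2|] := ltP (`|\tr (PSL2_mx g)|) 2; last first.
  rewrite le_eqVlt => /orP[/eqP tr2|hyp]; last by exfalso; apply: nhyp; left.
  exfalso; have [g1|/eqP g1] := eqVneq g 1%g; first by apply: npar; right.
  have [pp|np] := pselect (positive_parabolic g); first by apply: nhyp; right.
  by apply: npar; left.
have [b b0 eb] := ell_of_tr_lt2 tr2.
exists (2 * (pi - b)); split; first by lra.
apply: rotation_of_ell; first by lra.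
by have -> : pi - 2 * (pi - b) / 2 = b by field.
Qed.

End NormalizedMatrix.

(** * Words in the generators *)

(* Words are evaluated in PSL(2, R), in SL(2, R) and among the maps of the real
   line, so the target is any monoid with inverses of the chosen elements. *)
Section WordEvaluation.
Variables (n : nat) (T : Type) (op : T -> T -> T) (e : T).
Variables (f finv : 'I_n -> T).
Hypothesis opA : associative op.
Hypothesis op1 : left_id e op.
Hypothesis opr1 : right_id e op.
Hypothesis opV : forall i, op (f i) (finv i) = e.
Hypothesis opVl : forall i, op (finv i) (f i) = e.

Definition letter_eval (l : letter n) : T := if l.2 then finv l.1 else f l.1.

Definition word_eval (w : seq (letter n)) : T :=
  foldr (fun l => op (letter_eval l)) e w.

Lemma word_eval_cat u v : word_eval (u ++ v) = op (word_eval u) (word_eval v).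
Proof. by elim: u => [|l u IHu] /=; rewrite ?op1// IHu opA. Qed.

Hypothesis relator : foldr op e [seq f i | i <- enum 'I_n] = e.

Lemma word_eval_eq u v : word_eq u v -> word_eval u = word_eval v.
Proof.
elim=> //.
- by move=> u1 v1 w1 _ -> _ ->.
- by move=> u1 u2 v1 v2 _ e1 _ e2; rewrite !word_eval_cat e1 e2.
- by move=> [i b]; rewrite /word_eval /= /letter_eval /= opr1; case: b.
- rewrite /= -relator /word_eval; elim: (enum 'I_n) => //= i s IHs.
  by rewrite IHs.
Qed.

Definition group_eval (x : sphere_group n) : T := word_eval (repr x).

Lemma group_eval_pi w : group_eval (\pi_(sphere_group n) w) = word_eval w.
Proof. exact/word_eval_eq/repr_pi_word. Qed.

Lemma group_evalM x y : group_eval (x * y)%g = op (group_eval x) (group_eval y).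
Proof. by rewrite /group_eval -word_eval_cat; exact: group_eval_pi. Qed.

Lemma group_eval_loop i : group_eval (puncture_loop i) = f i.
Proof. by rewrite group_eval_pi /word_eval /= opr1. Qed.

End WordEvaluation.

(** The generator met after [j] others when a product of all generators acts
    on a point, rightmost factor first. *)
Definition rgen (m j : nat) : 'I_m.+1 := inord (m - j).

Lemma rgen_rev (m : nat) (i : 'I_m.+1) : rgen m (m - i) = i.
Proof. by rewrite /rgen subKn ?inord_val// -ltnS ltn_ord. Qed.

Lemma foldr_enum_rprod (T : Type) (op : T -> T -> T) (e : T) (m : nat)
    (f : 'I_m.+1 -> T) : right_id e op ->
  foldr op e [seq f i | i <- enum 'I_m.+1] = rprod op (f \o rgen m) m.
Proof.
move=> opr1.
have -> : [seq f i | i <- enum 'I_m.+1] = [seq f (inord k) | k <- iota 0 m.+1].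
  rewrite -val_enum_ord -map_comp; apply: eq_map => i /=.
  by rewrite inord_val.
suff H j : (j <= m)%N -> foldr op e [seq f (inord k) | k <- iota (m - j) j.+1] =
    rprod op (f \o rgen m) j by rewrite -(H m)// subnn.
elim: j => [_|j IHj jm]; first by rewrite /= opr1.
rewrite -[iota _ _]/((m - j.+1)%N :: iota (m - j.+1).+1 j.+1) subnSK// map_cons.
by congr op; exact: IHj (ltnW jm).
Qed.

Section Homomorphisms.
Variables (R : realType) (n : nat).
Implicit Types (rho : HomPi R n) (x y : sphere_group n).

Lemma HomPiM rho x y : rho (x * y)%g = (rho x * rho y)%g.
Proof. by case: rho => f fP; exact: (set_mem fP). Qed.

Lemma HomPi1 rho : rho 1%g = 1%g.
Proof.
have := HomPiM rho 1%g 1%g; rewrite mulg1 => r1.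
by apply: (mulgI (rho 1%g)); rewrite -r1 mulg1.
Qed.

Lemma HomPiV rho x : rho x^-1%g = (rho x)^-1%g.
Proof.
apply: (mulgI (rho x)); by rewrite -HomPiM !mulgV HomPi1.
Qed.

Lemma pi_word_cons (l : letter n) w :
  \pi_(sphere_group n) (l :: w) =
  (\pi_(sphere_group n) [:: l] * \pi_(sphere_group n) w)%g.
Proof.
apply/pi_word_eq; rewrite -cat1s.
by apply: word_eq_cat; apply: word_eq_sym; exact: repr_pi_word.
Qed.

Lemma pi_inv_letter i : \pi_(sphere_group n) [:: (i, true)] =
  (puncture_loop i)^-1%g.
Proof.
apply: (mulgI (puncture_loop i)); rewrite mulgV -pi_word_cons.
exact/pi_word_eq/(word_eq_cancel (i, false)).
Qed.

Lemma HomPi_word rho w : rho (\pi_(sphere_group n) w) =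
  word_eval *%g 1%g (fun i => rho (puncture_loop i))
    (fun i => (rho (puncture_loop i))^-1%g) w.
Proof.
elim: w => [|[i b] w IHw]; first exact: HomPi1.
rewrite pi_word_cons HomPiM IHw /=; congr (_ * _)%g.
by rewrite /letter_eval /=; case: b => //; rewrite pi_inv_letter HomPiV.
Qed.

Lemma HomPi_relator rho :
  foldr *%g 1%g [seq rho (puncture_loop i) | i <- enum 'I_n] = 1%g.
Proof.
rewrite -[RHS](HomPi1 rho) (_ : 1%g = \pi_(sphere_group n) [seq (i, false) | i <- enum 'I_n]).
  by rewrite HomPi_word /word_eval; elim: (enum 'I_n) => //= i s ->.
by apply/pi_word_eq/word_eq_sym; exact: word_eq_relator.
Qed.

Lemma HomPi_ext (rho sigma : HomPi R n) :
  (forall i, rho (puncture_loop i) = sigma (puncture_loop i)) -> rho = sigma.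
Proof.
move=> rs; apply: val_inj; apply/funext => x /=.
change (rho x = sigma x); rewrite -[x]reprK !HomPi_word.
by elim: (repr x) => //= -[i b] w ->; rewrite /letter_eval /= rs.
Qed.

Section Construction.
Variable g : 'I_n -> PSL2 R.

Definition hom_fun (x : sphere_group n) : PSL2 R :=
  group_eval *%g 1%g g (fun i => (g i)^-1%g) x.

Hypothesis relator : foldr *%g 1%g [seq g i | i <- enum 'I_n] = 1%g.

Lemma hom_fun_morph : {morph hom_fun : x y / (x * y)%g}.
Proof.
move=> x y; rewrite /hom_fun; apply: group_evalM => //.
- exact: mulgA.
- exact: mul1g.
- exact: mulg1.
- by move=> i; rewrite mulgV.
- by move=> i; rewrite mulVg.
Qed.

Definition mk_hom : HomPi R n := exist _ (hom_fun : {ptws _ -> _}) (mem_set hom_fun_morph).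

Lemma mk_hom_loop i : mk_hom (puncture_loop i) = g i.
Proof.
rewrite /mk_hom /HomPi_fun /=; apply: group_eval_loop => //.
- exact: mulgA.
- exact: mul1g.
- exact: mulg1.
- by move=> j; rewrite mulgV.
- by move=> j; rewrite mulVg.
Qed.

End Construction.
End Homomorphisms.

(** * Lifts to the universal cover *)

Section Lifts.
Variable R : realType.
Implicit Types (g h : PSL2 R) (M A B : 'M[R]_2) (b t x y z : R) (F G : R -> R).

Lemma RP1_vecE x :
  (RP1_vec x 0 0 = sin (x / 2)) * (RP1_vec x 1 0 = cos (x / 2)).
Proof. by rewrite !mxE. Qed.

Lemma col2P (u v : 'cV[R]_2) : u 0 0 = v 0 0 -> u 1 0 = v 1 0 -> u = v.
Proof.
by move=> e0 e1; apply/matrixP => i j; rewrite (ord1 j);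
  case: (ord2P i) => ->.
Qed.

Lemma RP1_vecD2pi x : RP1_vec (x + 2 * pi) = - RP1_vec x.
Proof.
have e : (x + 2 * pi) / 2 = x / 2 + pi by field.
by apply: col2P; rewrite [RHS]mxE !RP1_vecE e ?sinDpi ?cosDpi.
Qed.

Lemma RP1_vec_shift x (m : int) :
  exists2 e : R, e * e = 1 & RP1_vec (x + 2 * pi * m%:~R) = e *: RP1_vec x.
Proof.
elim/int_rec: m => [|n [e e1 ve]|n [e e1 ve]].
- by exists 1; rewrite ?mulr1// mulr0 addr0 scale1r.
- exists (- e); first by rewrite mulrNN.
  have -> : x + 2 * pi * (n.+1%:Z)%:~R = x + 2 * pi * (n%:Z)%:~R + 2 * pi.
    by rewrite intS intrD; ring.
  by rewrite RP1_vecD2pi ve scaleNr.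
- exists (- e); first by rewrite mulrNN.
  apply: oppr_inj; rewrite -RP1_vecD2pi scaleNr opprK -ve; congr RP1_vec.
  by rewrite intS opprD intrD; ring.
Qed.

Lemma sin_eq0_int z : sin z = 0 -> exists m : int, z = pi * m%:~R.
Proof.
have p0 := pi_gt0 R.
move=> sz; exists (Num.floor (z / pi)); set m := Num.floor _.
pose r := z - pi * m%:~R.
have r0 : 0 <= r < pi.
  have /andP[h1 h2] := floor_itv (z / pi); rewrite -/m in h1 h2.
  rewrite ler_pdivlMr// in h1; rewrite intrD ltr_pdivrMr// in h2.
  by apply/andP; split; rewrite /r; lra.
have [e e1] := RP1_vec_shift (2 * r) m.
have -> : 2 * r + 2 * pi * m%:~R = 2 * z by rewrite /r; ring.
move=> /matrixP/(_ 0 0); rewrite [RHS]mxE !RP1_vecE.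
have -> : 2 * z / 2 = z by field.
have -> : 2 * r / 2 = r by field.
rewrite sz => /eqP; rewrite eq_sym mulf_eq0 => /orP[/eqP e0|/eqP sr].
  by move: e1; rewrite e0 mul0r => /eqP; rewrite eq_sym oner_eq0.
suff : r = 0 by rewrite /r; lra.
move: r0 => /andP[]; rewrite le_eqVlt => /orP[/eqP//|r0 rpi].
by have := @sin_gt0_pi R r; rewrite r0 rpi sr ltxx => /(_ isT).
Qed.

Lemma RP1_vec_cross x y (k l : R) : k *: RP1_vec x = l *: RP1_vec y ->
  k * sin ((x - y) / 2) = 0 /\ k * cos ((x - y) / 2) = l.
Proof.
move=> /matrixP e; have := e 0 0; have := e 1 0.
rewrite !mxE /= => e1 e0.
rewrite mulrBl sinB cosB; split.
  by rewrite mulrBr !mulrA e0 e1; ring.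
transitivity (l * (cos (y / 2) ^+ 2 + sin (y / 2) ^+ 2)).
  by rewrite mulrDr !mulrA e0 e1; ring.
by rewrite cos2Dsin2 mulr1.
Qed.

(** The fibres of the universal cover of [RP^1] are the orbits of
    [x |-> x + 2 pi]. *)
Lemma same_line x y (k l : R) : k != 0 -> k *: RP1_vec x = l *: RP1_vec y ->
  exists m : int, x = y + 2 * pi * m%:~R.
Proof.
move=> k0 /RP1_vec_cross[/eqP]; rewrite mulf_eq0 (negbTE k0) /= => /eqP.
by move=> /sin_eq0_int[m xy] _; exists m; move: xy; lra.
Qed.

(** On the double cover of [RP^1] by rays, the deck group is generated by
    [x |-> x + 4 pi]. *)
Lemma same_ray x y (k l : R) : 0 < k -> 0 < l ->
  k *: RP1_vec x = l *: RP1_vec y -> x - y < 4 * pi -> - (4 * pi) < x - y ->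
  x = y.
Proof.
have p0 := pi_gt0 R.
move=> k0 l0 e h1 h2; have [m xy] := same_line (lt0r_neq0 k0) e.
have [_ c] := RP1_vec_cross e.
have c0 : 0 < cos ((x - y) / 2) by rewrite -(pmulr_rgt0 _ k0) c.
have e2 : (x - y) / 2 = pi * m%:~R by rewrite xy; field.
have mlt : m < 2.
  rewrite -(ltr_int R) -(ltr_pM2l p0) -e2; lra.
have mgt : -2 < m.
  rewrite -(ltr_int R) -(ltr_pM2l p0) -e2; lra.
have : m = 0 \/ m = 1 \/ m = -1 by move: mlt mgt; lia.
case=> [m0|[m0|m0]]; rewrite m0 ?mulr0 ?mulr1 ?mulrN1 in e2; first by lra.
  by move: c0; rewrite e2 cospi oppr_gt0 ltr10.
by move: c0; rewrite e2 cosN cospi oppr_gt0 ltr10.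
Qed.

Definition across M := fun x =>
  cos (x / 2) * (M 0 0 * sin (x / 2) + M 0 1 * cos (x / 2)) -
  sin (x / 2) * (M 1 0 * sin (x / 2) + M 1 1 * cos (x / 2)).

Definition along M := fun x =>
  sin (x / 2) * (M 0 0 * sin (x / 2) + M 0 1 * cos (x / 2)) +
  cos (x / 2) * (M 1 0 * sin (x / 2) + M 1 1 * cos (x / 2)).

(** A matrix of [ell b] moves every line clockwise: no vector is mapped to a
    multiple of itself. So it lifts to a map that decreases the angular
    coordinate by an amount in [(0, 2 pi)], read off from the coordinates
    [along M x] and [across M x] of the image of [RP1_vec x] in the direct orthonormal
    frame starting at [RP1_vec x]. *)
Definition cw_lift M x := x - (pi + 2 * atan (along M x / across M x)).

Lemma across_lt0 b M x : 0 < b < pi -> ell b M -> across M x < 0.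
Proof.
move=> b0 eM; rewrite -oppr_gt0 /across.
have : (sin (x / 2) != 0) || (cos (x / 2) != 0).
  rewrite -negb_and; apply/negP => /andP[/eqP s0 /eqP c0].
  have := cos2Dsin2 (x / 2); rewrite s0 c0 !expr0n /= addr0 => /eqP.
  by rewrite eq_sym oner_eq0.
by move=> /(ell_form_gt0 b0 eM); congr (0 < _); ring.
Qed.

Lemma cw_lift_bounds M x : x - 2 * pi < cw_lift M x < x.
Proof.
have := atan_gtNpi2 (along M x / across M x); have := atan_ltpi2 (along M x / across M x).
by rewrite /cw_lift; lra.
Qed.

Lemma continuous_cw_lift b M : 0 < b < pi -> ell b M -> continuous (cw_lift M).
Proof.
move=> b0 eM x.
have ch y : {for y, continuous (fun z : R => z / 2)}.
  by apply: ctM; [exact: cvg_id|exact: ct_cst].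
have cs : {for x, continuous (fun z : R => sin (z / 2))}.
  by apply: ct_comp (ch x) _; exact: continuous_sin.
have cc : {for x, continuous (fun z : R => cos (z / 2))}.
  by apply: ct_comp (ch x) _; exact: continuous_cos.
have cl (a c : R) :
    {for x, continuous (fun z : R => a * sin (z / 2) + c * cos (z / 2))}.
  by apply: ctD; apply: ctM => //; exact: ct_cst.
change {for x, continuous
  (fun z : R => z - (pi + 2 * atan (along M z / across M z)))}.
apply: ctB; first exact: cvg_id.
apply: ctD; first exact: ct_cst.
apply: ctM; first exact: ct_cst.
apply: ct_comp; last exact: continuous_atan.
apply: ct_div; first by rewrite lt_eqF// (across_lt0 _ b0 eM).
  by apply: ctD; apply: ctM.
by apply: ctB; apply: ctM.
Qed.

Lemma cw_lift_spec b M x : 0 < b < pi -> ell b M ->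
  exists2 k : R, 0 < k & M *m RP1_vec x = k *: RP1_vec (cw_lift M x).
Proof.
move=> b0 eM; have o0 := across_lt0 x b0 eM.
set a := atan (along M x / across M x).
have ca : 0 < cos a.
  by apply: cos_gt0_pihalf; rewrite /a atan_gtNpi2 atan_ltpi2.
have ta : sin a = along M x / across M x * cos a.
  by rewrite -{1}[along M x / across M x]atanK -/a /tan mulfVK// lt0r_neq0.
exists (- across M x / cos a); first by rewrite divr_gt0// oppr_gt0.
have e : cw_lift M x / 2 = x / 2 - (a + pi / 2) by rewrite /cw_lift -/a; field.
have cp : cos (a + pi / 2) = - sin a by rewrite cosDpihalf.
have sp : sin (a + pi / 2) = cos a by rewrite sinDpihalf.
have on0 : across M x != 0 by rewrite lt_eqF.
have cn0 : cos a != 0 by rewrite lt0r_neq0.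
apply: col2P; rewrite mulmx2E [RHS]mxE !RP1_vecE e ?sinB ?cosB cp sp ta.
  transitivity ((along M x * sin (x / 2) + across M x * cos (x / 2))); last by field; rewrite on0.
  rewrite -[LHS]mulr1 -[X in _ * X](cos2Dsin2 (x / 2)) /along /across; ring.
transitivity ((along M x * cos (x / 2) - across M x * sin (x / 2))); last by field; rewrite on0.
rewrite -[LHS]mulr1 -[X in _ * X](cos2Dsin2 (x / 2)) /along /across; ring.
Qed.

Lemma cw_lift_unique b M x y k : 0 < b < pi -> ell b M -> 0 < k ->
  M *m RP1_vec x = k *: RP1_vec y -> x - 4 * pi < y < x + 2 * pi ->
  y = cw_lift M x.
Proof.
move=> b0 eM k0 e h; have [l l0] := cw_lift_spec x b0 eM.
rewrite e => e'; have := cw_lift_bounds M x => hd.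
by apply: same_ray k0 l0 e' _ _; lra.
Qed.

Lemma cw_liftD2pi b M x : 0 < b < pi -> ell b M ->
  cw_lift M (x + 2 * pi) = cw_lift M x + 2 * pi.
Proof.
have p0 := pi_gt0 R.
move=> b0 eM; have [k k0 e] := cw_lift_spec x b0 eM.
apply/esym; apply: (cw_lift_unique b0 eM k0); last by have := cw_lift_bounds M x; lra.
by rewrite !RP1_vecD2pi mulmxN e scalerN.
Qed.

Lemma cw_liftD b M x (m : int) : 0 < b < pi -> ell b M ->
  cw_lift M (x + 2 * pi * m%:~R) = cw_lift M x + 2 * pi * m%:~R.
Proof.
move=> b0 eM.
have S1 (y : R) (k : nat) :
    cw_lift M (y + 2 * pi * k%:R) = cw_lift M y + 2 * pi * k%:R.
  elim: k => [|k IHk]; first by rewrite mulr0 !addr0.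
  have -> : y + 2 * pi * k.+1%:R = y + 2 * pi * k%:R + 2 * pi.
    by rewrite -natr1; ring.
  by rewrite (cw_liftD2pi _ b0 eM) IHk -natr1; ring.
case: m => k; first exact: S1.
rewrite NegzE rmorphN /= mulrN.
have := S1 (x - 2 * pi * k.+1%:R) k.+1; rewrite subrK => ->.
by rewrite -pmulrn; ring.
Qed.

(** Turning by twice [b] and then by twice [pi - b] about the same centre makes
    a full turn. *)
Lemma cw_lift_adj b M x : 0 < b < pi -> ell b M ->
  cw_lift (- adj2 M) (cw_lift M x) = x - 2 * pi.
Proof.
have p0 := pi_gt0 R.
move=> b0 eM; have [k k0 e] := cw_lift_spec x b0 eM.
have b0' : 0 < pi - b < pi by lra.
apply/esym; apply: (cw_lift_unique b0' (ell_adj eM) (k := k^-1)).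
- by rewrite invr_gt0.
- have -> : RP1_vec (cw_lift M x) = k^-1 *: (M *m RP1_vec x).
    by rewrite e scalerA mulVf ?scale1r// lt0r_neq0.
  rewrite -scalemxAr mulNmx mulmxA adj2_mul; last by case: eM.
  rewrite mul1mx -[in LHS](subrK (2 * pi) x) RP1_vecD2pi opprK.
  by [].
- by have := cw_lift_bounds M x; lra.
Qed.

End Lifts.

Section LiftsOfElements.
Variable R : realType.
Implicit Types (g h : PSL2 R) (M A B : 'M[R]_2) (b t x y z : R) (F G : R -> R).

Lemma is_lift_of_mx g M F (e : R) : PSL2_mx g = e *: M -> e != 0 ->
  continuous F ->
  (forall x, exists2 k : R, k != 0 & M *m RP1_vec x = k *: RP1_vec (F x)) ->
  is_lift g F.
Proof.
move=> gM e0 cF MF; split=> // x; have [k k0 kE] := MF x.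
by exists (e * k); rewrite ?mulf_neq0// gM -scalemxAl kE scalerA.
Qed.

Lemma PSL2_mx_norm g : PSL2_mx g 1 0 != 0 ->
  exists2 e : R, e != 0 & PSL2_mx g = e *: norm_mx g.
Proof.
move=> /norm_mx_sign gN; apply: scale_of_sign.
by case: gN => ->; rewrite ?opprK; [left|right].
Qed.

Lemma is_lift_cw_lift b g : 0 < b < pi -> ell b (norm_mx g) ->
  is_lift g (cw_lift (norm_mx g)).
Proof.
move=> b0 eg; have [e e0 ge] := PSL2_mx_norm (ell_norm_mx_neq0 eg).
apply: (is_lift_of_mx ge e0); first exact: continuous_cw_lift eg.
move=> x; have [k k0 kE] := cw_lift_spec x b0 eg.
by exists k; rewrite ?lt0r_neq0.
Qed.

Lemma is_lift_comp g h F G : is_lift g F -> is_lift h G ->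
  is_lift (g * h)%g (F \o G).
Proof.
move=> [cF FP] [cG GP].
have [e e0 ghE] := scale_of_sign (PSL2_mxM g h).
apply: (is_lift_of_mx ghE e0).
  by move=> x; apply: continuous_comp; [exact: cG|exact: cF].
move=> x; have [k k0 kE] := GP x; have [l l0 lE] := FP (G x).
exists (k * l); first by rewrite mulf_neq0.
by rewrite -mulmxA kE -scalemxAr lE scalerA.
Qed.

Lemma is_lift_id : is_lift (1%g : PSL2 R) id.
Proof.
have [e e0 eE] := scale_of_sign (PSL2_mx1 R).
apply: (is_lift_of_mx eE e0); first by move=> x; exact: cvg_id.
by move=> x; exists 1; rewrite ?oner_neq0// mul1mx scale1r.
Qed.

Lemma is_lift_shift g F (m : int) : is_lift g F ->
  is_lift g (fun x => F x + 2 * pi * m%:~R).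
Proof.
move=> [cF FP]; split.
  move=> x; change {for x, continuous (fun z : R => F z + 2 * pi * m%:~R)}.
  by apply: ctD; [exact: (cF x)|exact: ct_cst].
move=> x; have [k k0 ->] := FP x; have [e e1 ->] := RP1_vec_shift (F x) m.
have e0 : e != 0 by apply: contra_eqN e1 => /eqP->; rewrite mul0r eq_sym oner_eq0.
exists (k * e); first by rewrite mulf_neq0.
by rewrite scalerA -mulrA e1 mulr1.
Qed.

(** Lifts of a projective transformation differ by a deck transformation: their
    difference is continuous with values in [2 pi Z]. *)
Lemma is_lift_unique g F G : is_lift g F -> is_lift g G ->
  exists m : int, forall x, F x = G x + 2 * pi * m%:~R.
Proof.
have p0 := pi_gt0 R.
move=> [cF FP] [cG GP].
have H x : exists m : int, F x = G x + 2 * pi * m%:~R.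
  have [k k0 e] := FP x; have [l l0 e'] := GP x.
  by rewrite e in e'; exact: same_line k0 e'.
pose D x := (F x - G x) / 2.
have D0 x : sin (D x) = 0.
  have [m FG] := H x; have [e _] := RP1_vec_shift (0 : R) m; move=> /matrixP/(_ 0 0).
  rewrite [RHS]mxE !RP1_vecE mul0r sin0 mulr0 add0r => s0.
  by rewrite -[RHS]s0; congr sin; rewrite /D FG; field.
have cD : continuous D.
  move=> x; change {for x, continuous (fun z : R => (F z - G z) / 2)}.
  by apply: ctM; [apply: ctB; [exact: (cF x)|exact: (cG x)]|exact: ct_cst].
have Dle x y : x <= y -> D x = D y.
  move=> xy; apply/eqP/negPn/negP => Dxy.
  have gap u v : D u < D v -> D u + pi / 2 < D v.
    move=> uv; rewrite ltNge; apply/negP => vu.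
    have : 0 < sin (D v - D u) by apply: sin_gt0_pi; lra.
    by rewrite sinB !D0 mul0r mulr0 subrr ltxx.
  have bad u v : D u + pi / 2 = D v -> False.
    move=> uv; have := D0 v; rewrite -uv sinDpihalf => c0.
    by have := cos2Dsin2 (D u); rewrite D0 c0 !expr0n /= addr0 => /eqP;
      rewrite eq_sym oner_eq0.
  have cw : {within `[x, y], continuous D} by exact: continuous_subspaceT.
  have ivt v : Num.min (D x) (D y) <= v <= Num.max (D x) (D y) ->
      exists2 c, c \in `[x, y] & D c = v by apply: IVT.
  case: (ltgtP (D x) (D y)) Dxy => // h _.
    have g1 := gap _ _ h; have [|c _ cE] := ivt (D x + pi / 2).
      by rewrite min_l ?max_r; lra.
    exact: (bad x c).
  have g1 := gap _ _ h; have [|c _ cE] := ivt (D y + pi / 2).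
    by rewrite min_r ?max_l; lra.
  exact: (bad y c).
have [m mE] := H 0; exists m => x.
have : D x = D 0.
  by have [x0|x0] := leP x 0; [exact: Dle|apply/esym/Dle/ltW].
by rewrite /D mE; lra.
Qed.

Lemma sin_shift_nat m t : sin (t + m%:R * pi) = (-1) ^+ m * sin t :> R.
Proof.
elim: m => [|m IHm]; first by rewrite mul0r addr0 expr0 mul1r.
by rewrite -natr1 mulrDl mul1r addrA sinDpi IHm exprS mulN1r mulNr.
Qed.

(** Real sequences issued from 0 whose steps are in [(0, pi)] stay within
    [pi] of each other if their sines have the same signs: they enter together
    each interval on which the sine has a constant sign. *)
Lemma winding_bound (y z : nat -> R) : y 0%N = 0 -> z 0%N = 0 ->
  (forall j, 0 < y j.+1 - y j < pi) -> (forall j, 0 < z j.+1 - z j < pi) ->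
  (forall j, exists2 c, 0 < c & sin (y j) = c * sin (z j)) ->
  forall j, `|y j - z j| < pi.
Proof.
have p0 := pi_gt0 R.
move=> y0 z0 yS zS yz j.
have [m [my mz]] : exists m : nat, m%:R * pi <= y j < m.+1%:R * pi /\
    m%:R * pi <= z j < m.+1%:R * pi.
  elim: j => [|j [m [my mz]]].
    by exists 0%N; rewrite y0 z0 mul0r mul1r; lra.
  have := yS j; have := zS j; rewrite -!natr1 in my mz *.
  have [c c0] := yz j.+1; move: my mz.
  move: (y j) (z j) (y j.+1) (z j.+1) => a b a' b' ha hb sab hb' ha'.
  have pos t : m%:R * pi < t < (m%:R + 1) * pi -> 0 < (-1) ^+ m * sin t.
    move=> ht; rewrite -[t](subrK (m%:R * pi)) sin_shift_nat mulrA -exprMn.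
    by rewrite mulrNN mulr1 expr1n mul1r; apply: sin_gt0_pi; lra.
  have neg t : (m%:R + 1) * pi <= t < (m%:R + 1 + 1) * pi ->
      (-1) ^+ m * sin t <= 0.
    move=> ht; rewrite -[t](subrK (m.+1%:R * pi)) sin_shift_nat mulrA exprS.
    rewrite mulN1r mulrN -exprMn mulrNN mulr1 expr1n mulN1r oppr_le0.
    by apply: sin_ge0_pi; rewrite -natr1; lra.
  have [ca|ca] := ltP a' ((m%:R + 1) * pi); have [cb|cb] := ltP b' ((m%:R + 1) * pi).
  - by exists m; rewrite -natr1; split; lra.
  - have := pos a'; have := neg b'; rewrite sab mulrCA pmulr_rgt0//.
    by move=> h1 h2; exfalso; have := h1 _; have := h2 _; lra.
  - have := pos b'; have := neg a'; rewrite sab mulrCA pmulr_rle0//.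
    by move=> h1 h2; exfalso; have := h1 _; have := h2 _; lra.
  - by exists m.+1; rewrite -!natr1; split; lra.
rewrite -natr1 in my mz; rewrite ltr_norml; lra.
Qed.

Lemma cw_lift_iter b M j : 0 < b < pi -> ell b M ->
  exists2 c : R, 0 < c & sin (- iter j (cw_lift M) 0 / 2) = c * sin (j%:R * b).
Proof.
move=> b0 eM; have sb := sin_gt0_pi b0; have dM := ell_det eM.
have [dt c0 tr] := eM; rewrite det2 in dt; rewrite mxtrace2 in tr.
have sbn := lt0r_neq0 sb.
(* The image of [RP1_vec 0] under the rotation about the centre of [M] by twice
   the angle [t], clockwise. *)
pose u (t : R) : 'cV[R]_2 := \col_i if i == 0 then sin t / sin b * M 0 1
   else cos t + sin t / sin b * (M 1 1 - cos b).
have uS t : M *m u t = u (t + b).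
  have m00 : M 0 0 = 2 * cos b - M 1 1 by lra.
  apply: col2P; rewrite mulmx2E !mxE /= sinD ?cosD ?m00; first by field.
  have -> : M 1 0 * (sin t / sin b * M 0 1) =
     sin t / sin b * ((2 * cos b - M 1 1) * M 1 1 - (cos b ^+ 2 + sin b ^+ 2)).
    rewrite cos2Dsin2 mulrCA; congr (_ * _); rewrite -m00; lra.
  by field.
have uE k : exists2 c, 0 < c & c *: RP1_vec (iter k (cw_lift M) 0) = u (k%:R * b).
  elim: k => [|k [c cp cE]].
    exists 1 => //; rewrite scale1r /=; apply: col2P;
    by rewrite RP1_vecE !mxE /= !mul0r ?sin0 ?cos0 ?mul0r ?addr0.
  have [d d0 dE] := cw_lift_spec (iter k (cw_lift M) 0) b0 eM.
  exists (c * d); first by rewrite mulr_gt0.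
  by rewrite -scalerA /= -dE scalemxAr cE uS -natr1 mulrDl mul1r.
have [c cp /matrixP/(_ 0 0)] := uE j.
rewrite !mxE /= mulNr sinN => e.
have m01 : 0 < - M 0 1.
  rewrite -(pmulr_lgt0 _ c0) dM ltr_pwDl ?sqr_ge0// exprn_gt0//.
exists (- M 0 1 / sin b / c); first by rewrite !divr_gt0.
apply: (mulfI (lt0r_neq0 cp)); rewrite mulrN e; field.
by rewrite sbn lt0r_neq0.
Qed.

(** Along an orbit of [cw_lift M], the angular coordinate stays at bounded distance
    from that of an orbit of the rotation [x |-> x - 2 b]. *)
Lemma translation_number_cw_lift b M (m : int) : 0 < b < pi -> ell b M ->
  translation_number (fun x => cw_lift M x + 2 * pi * m%:~R) =
  - 2 * b + 2 * pi * m%:~R.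
Proof.
have p0 := pi_gt0 R.
move=> b0 eM; set F := fun x => _.
have iE k : iter k F 0 = iter k (cw_lift M) 0 + 2 * pi * m%:~R * k%:R.
  elim: k => [|k IHk]; first by rewrite /= mulr0 addr0.
  rewrite iterS IHk /F -[_ * m%:~R * _]mulrA -[k%:R]/(k%:~R) -intrM.
  by rewrite (cw_liftD _ _ b0 eM) intrM -natr1 /=; ring.
have bound k : `|- iter k (cw_lift M) 0 / 2 - k%:R * b| < pi.
  apply: (winding_bound (y := fun k => - iter k (cw_lift M) 0 / 2)
    (z := fun k => k%:R * b)).
  - by rewrite /= oppr0 mul0r.
  - by rewrite mul0r.
  - by move=> j; have := cw_lift_bounds M (iter j (cw_lift M) 0); rewrite /=; lra.
  - by move=> j; rewrite -natr1 mulrDl; lra.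
  - by move=> j; exact: cw_lift_iter.
rewrite /translation_number; apply: cvg_lim => //.
apply/cvgrPdist_le => e e0; near=> k.
have k0 : 0 < k%:R :> R by rewrite ltr0n; near: k; exists 1%N.
have kL : 2 * pi / e <= k%:R by near: k; exact: nbhs_infty_ger.
rewrite subr0 iE.
have -> : - 2 * b + 2 * pi * m%:~R -
   (iter k (cw_lift M) 0 + 2 * pi * m%:~R * k%:R) / k%:R =
   2 * (- iter k (cw_lift M) 0 / 2 - k%:R * b) / k%:R.
  by field; rewrite lt0r_neq0.
rewrite normrM normfV (ger0_norm (ltW k0)) ler_pdivrMr//.
rewrite normrM ger0_norm//; rewrite ler_pdivrMr// in kL.
have := bound k; lra.
Unshelve. all: by end_near. Qed.

End LiftsOfElements.

Lemma is_lift_inv (R : realType) (g : PSL2 R) (F G : R -> R) :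
  is_lift g F -> continuous G -> (forall x, F (G x) = x) -> is_lift g^-1%g G.
Proof.
move=> [_ FP] cG FG.
have [e e0 gE] := scale_of_sign (PSL2_mxV g).
apply: (is_lift_of_mx gE e0 cG) => x; have [k k0 kE] := FP (G x).
exists k^-1; first by rewrite invr_eq0.
rewrite FG in kE; have -> : RP1_vec x = k^-1 *: (PSL2_mx g *m RP1_vec (G x)).
  by rewrite kE scalerA mulVf// scale1r.
by rewrite -scalemxAr mulmxA adj2_mul ?det_PSL2_mx// mul1mx.
Qed.

(** * The Euler class *)

Section EulerClass.
Variable R : realType.

Variables (m : nat) (rho : HomPi R m.+1) (b : 'I_m.+1 -> R).

Let g i := rho (puncture_loop i).
Let B i := norm_mx (g i).
Let F i := cw_lift (B i).

Hypothesis b0 : forall i, 0 < b i < pi.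
Hypothesis eB : forall i, ell (b i) (B i).

Lemma foldr_shift (f : 'I_m.+1 -> int) (s : seq 'I_m.+1) x :
  foldr comp id [seq (fun x => F i x + 2 * pi * (f i)%:~R) | i <- s] x =
  foldr comp id [seq F i | i <- s] x + 2 * pi * (\sum_(i <- s) f i)%:~R.
Proof.
elim: s => [|i s IHs] /=; first by rewrite big_nil mulr0 addr0.
rewrite big_cons IHs [F i _](cw_liftD _ _ (b0 i) (eB i)) intrD.
by rewrite -/(F i); ring.
Qed.

Lemma is_lift_foldr (f : 'I_m.+1 -> R -> R) (s : seq 'I_m.+1) :
  (forall i, is_lift (g i) (f i)) ->
  is_lift (foldr *%g 1%g [seq g i | i <- s]) (foldr comp id [seq f i | i <- s]).
Proof.
move=> gf; elim: s => [|i s IHs] /=; first exact: is_lift_id.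
exact: is_lift_comp.
Qed.

(** The relator maps to 1 in PSL(2, R), so the composite of the clockwise lifts
    is a deck transformation. *)
Lemma lift_relator : exists k : int,
  forall x, foldr comp id [seq F i | i <- enum 'I_m.+1] x = x + 2 * pi * k%:~R.
Proof.
have := @is_lift_foldr F (enum 'I_m.+1)
  (fun i => is_lift_cw_lift (b0 i) (eB i)).
rewrite [X in is_lift X](HomPi_relator rho) => h.
exact: (is_lift_unique h (is_lift_id R)).
Qed.

Section GivenLift.
Variable k : int.
Hypothesis Fk : forall x,
  foldr comp id [seq F i | i <- enum 'I_m.+1] x = x + 2 * pi * k%:~R.

(* The clockwise lifts do not satisfy the relator; shifting that of one
   generator by the defect [- k] makes them a lift of the representation. *)
Let f0 (i : 'I_m.+1) : int := if i == ord0 then - k else 0.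
Let f i := fun x => F i x + 2 * pi * (f0 i)%:~R.
Let finv i := fun x => cw_lift (- adj2 (B i)) (x - 2 * pi * (f0 i)%:~R) + 2 * pi.

Let eB' i : ell (pi - b i) (- adj2 (B i)).
Proof. exact: ell_adj. Qed.

Let b0' i : 0 < pi - b i < pi.
Proof. by have := b0 i; lra. Qed.

Let fV i : f i \o finv i = id.
Proof.
apply/funext => x; rewrite /f /finv /=.
rewrite [F i _](cw_liftD2pi _ (b0 i) (eB i)).
have := cw_lift_adj (x - 2 * pi * (f0 i)%:~R) (b0' i) (eB' i).
by rewrite adj2N adj2K opprK => ->; ring.
Qed.

Let fVl i : finv i \o f i = id.
Proof.
apply/funext => x; rewrite /f /finv /= addrK.
by rewrite (cw_lift_adj _ (b0 i) (eB i)) subrK.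
Qed.

Let frel : foldr comp id [seq f i | i <- enum 'I_m.+1] = id.
Proof.
apply/funext => x; rewrite foldr_shift Fk big_enum /= (bigD1 ord0)//=.
rewrite big1 ?addr0; last by move=> i /negbTE; rewrite /f0 => ->.
by rewrite /f0 eqxx rmorphN /=; ring.
Qed.

Let lift_f i : is_lift (g i) (f i).
Proof. exact/is_lift_shift/(is_lift_cw_lift (b0 i) (eB i)). Qed.

Let lift_finv i : is_lift (g i)^-1%g (finv i).
Proof.
apply: (is_lift_inv (lift_f i)); last by move=> x; rewrite -[RHS]/(id x) -(fV i).
move=> x; change {for x, continuous (fun x =>
  cw_lift (- adj2 (B i)) (x - 2 * pi * (f0 i)%:~R) + 2 * pi)}.
apply: ctD; last exact: ct_cst.
apply: (ct_comp (f := fun x => x - _)); last exact: (continuous_cw_lift (b0' i) (eB' i)).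
by apply: ctB; [exact: cvg_id|exact: ct_cst].
Qed.

Let rhot (x : sphere_group m.+1) : R -> R := group_eval comp id f finv x.

Let rhot_lift : is_lift_rep rho rhot.
Proof.
split=> [x|x y]; last by apply: group_evalM.
rewrite -{1}[x]reprK HomPi_word /rhot /group_eval.
elim: (repr x) => [|[i c] w IHw] /=; first exact: is_lift_id.
apply: is_lift_comp IHw; rewrite /letter_eval /=.
by case: c; [exact: lift_finv|exact: lift_f].
Qed.

Lemma lift_rep_one rhot' : is_lift_rep rho rhot' -> rhot' 1%g = id.
Proof.
move=> [rl rM]; have := rM 1%g 1%g; rewrite mulg1 => e.
have := rl 1%g; rewrite HomPi1 => l1.
have [l lE] := is_lift_unique l1 (is_lift_id R).
apply/funext => x; have := congr1 (@^~ x) e; rewrite /= !lE /=; lra.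
Qed.

Lemma lift_rep_relator rhot' : is_lift_rep rho rhot' ->
  foldr comp id [seq rhot' (puncture_loop i) | i <- enum 'I_m.+1] = id.
Proof.
move=> rr; have [rl rM] := rr.
suff H (s : seq 'I_m.+1) : foldr comp id [seq rhot' (puncture_loop i) | i <- s] =
    rhot' (\pi_(sphere_group m.+1) [seq (i, false) | i <- s]).
  rewrite H -[RHS](lift_rep_one rr); congr rhot'.
  exact/pi_word_eq/word_eq_relator.
elim: s => [|i s IHs] /=; first by rewrite -[LHS](lift_rep_one rr).
by rewrite pi_word_cons rM IHs.
Qed.

(** Another lift changes each generator by a deck transformation, and the
    relator makes these shifts sum to [- k]. *)
Lemma Vol_lift : Vol rho = 2 * \sum_i b i + 2 * pi * k%:~R.
Proof.
have val rhot' : is_lift_rep rho rhot' ->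
    - \sum_(i < m.+1) translation_number (rhot' (puncture_loop i)) =
    2 * \sum_i b i + 2 * pi * k%:~R.
  move=> rr; have [rl _] := rr.
  have /choice[c cE] : forall i, exists c : int, forall x,
      rhot' (puncture_loop i) x = F i x + 2 * pi * c%:~R.
    by move=> i; exact: is_lift_unique (rl _) (is_lift_cw_lift (b0 i) (eB i)).
  have cE' i : rhot' (puncture_loop i) = fun x => F i x + 2 * pi * (c i)%:~R.
    by apply/funext.
  have := lift_rep_relator rr.
  have -> : [seq rhot' (puncture_loop i) | i <- enum 'I_m.+1] =
      [seq (fun x => F i x + 2 * pi * (c i)%:~R) | i <- enum 'I_m.+1].
    exact: eq_map.
  move=> /(congr1 (@^~ 0)); rewrite foldr_shift Fk big_enum /= => sumc.
  under eq_bigr do rewrite cE' (translation_number_cw_lift _ (b0 _) (eB _)).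
  rewrite big_split /= -!mulr_sumr -rmorph_sum /=; lra.
rewrite /Vol; set S := [set v | _].
have : S (get S) by apply: (@getPex _ S); eexists; exists rhot; split.
by move=> [rhot' [rr ->]]; exact: val.
Qed.

Lemma euler_lift : euler rho = m.+1%:R + k%:~R.
Proof.
have p0 := pi_gt0 R.
have th i : theta_i rho i = 2 * pi - 2 * b i.
  rewrite /theta_i thetaP; last by have := b0 i; lra.
  have -> : pi - (2 * pi - 2 * b i) / 2 = b i by field.
  exact: eB.
rewrite /euler Vol_lift /Theta; under [X in _ + X]eq_bigr do rewrite th.
rewrite sumrB sumr_const card_ord -mulr_sumr -mulr_natr.
by move: (@pi R) p0 => q q0; field; rewrite lt0r_neq0.
Qed.

End GivenLift.
End EulerClass.

(** * Partial products of super-maximal representations *)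

Section Orbits.
Variable R : realType.
Variables (m : nat) (b : nat -> R) (B : nat -> 'M[R]_2).
Hypothesis b0 : forall j, 0 < b j < pi.
Hypothesis eB : forall j, ell (b j) (B j).

Local Notation T j := (rprod mulmx B j).
Local Notation D j := (rprod comp (fun i => cw_lift (B i)) j).

Lemma orbit_spec x j :
  exists2 c : R, 0 < c & T j *m RP1_vec x = c *: RP1_vec (D j x).
Proof.
elim: j => [|j [c c0 cE]]; first exact: (cw_lift_spec x (b0 0) (eB 0)).
have [d d0 dE] := cw_lift_spec (D j x) (b0 j.+1) (eB j.+1).
exists (c * d); first exact: mulr_gt0.
by rewrite /= -mulmxA cE -scalemxAr dE scalerA.
Qed.

Lemma orbit_lt x i j : (i < j)%N -> D j x < D i x.
Proof.
elim: j => // j IHj; rewrite ltnS leq_eqVlt => /orP[/eqP->|ij].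
  by have /andP[] := cw_lift_bounds (B j.+1) (D j x).
apply: lt_trans (IHj ij).
by have /andP[] := cw_lift_bounds (B j.+1) (D j x).
Qed.

Lemma orbit_lt0 x j : D j x < x.
Proof.
have h0 : D 0 x < x by have /andP[] := cw_lift_bounds (B 0%N) x.
by case: j => // j; apply: lt_trans (orbit_lt x (ltn0Sn j)) h0.
Qed.

Lemma T10_orbit j : exists2 c : R, 0 < c & T j 1 0 = c * cos (D j pi / 2).
Proof.
have [c c0 /matrixP/(_ 1 0)] := orbit_spec pi j.
rewrite mulmx2E [RHS]mxE !RP1_vecE sin_pihalf cos_pihalf mulr1 mulr0 addr0.
by move=> e; exists c.
Qed.

(** A composite that moves each point by more than 0 and less than a turn fixes
    no line, so the corresponding product has no real eigenvalue. *)
Lemma partial_elliptic : (forall x, D m x = x - 2 * pi) ->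
  forall j, (j < m)%N -> 0 < T j 1 0 /\ `|\tr (T j)| < 2.
Proof.
have p0 := pi_gt0 R.
move=> Dm j jm.
have Dj x : x - 2 * pi < D j x < x by rewrite -Dm orbit_lt// orbit_lt0.
have T0 : 0 < T j 1 0.
  have [c c0 ->] := T10_orbit j; rewrite mulr_gt0//.
  by apply: cos_gt0_pihalf; have := Dj pi; lra.
split=> //; rewrite ltNge; apply/negP => tr2.
have dT : \det (T j) = 1.
  elim: (j) => [|i IHi] /=; first by have [] := eB 0.
  by rewrite det_mulmx IHi mulr1; have [] := eB i.+1.
rewrite det2 in dT; rewrite mxtrace2 in tr2.
set a := T j 0 0 in dT tr2; set d := T j 1 1 in dT tr2.
set c := T j 1 0 in dT T0; set e := T j 0 1 in dT.
pose s := Num.sqrt ((a + d) ^+ 2 - 4).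
have s2 : s ^+ 2 = (a + d) ^+ 2 - 4.
  rewrite sqr_sqrtr// subr_ge0 -real_normK ?num_real//.
  by have := normr_ge0 (a + d); nra.
(* If the eigenvalues were real, [(z, 1)] would be an eigenvector. *)
pose z := (a - d + s) / (2 * c).
have cn0 := lt0r_neq0 T0.
have zE : a * z + e = z * (c * z + d).
  apply: (mulfI cn0); have -> : c * (a * z + e) = a * (c * z) + (a * d - 1) by rewrite mulrDr -dT; ring.
  have -> : c * z = (a - d + s) / 2 by rewrite /z; field.
  have -> : c * (z * ((a - d + s) / 2 + d)) = (c * z) * ((a - d + s) / 2 + d) by ring.
  have -> : c * z = (a - d + s) / 2 by rewrite /z; field.
  have : s * s = (a + d) ^+ 2 - 4 by rewrite -s2.
  move=> ss; lra.
pose x := 2 * atan z.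
have xE : T j *m RP1_vec x = (c * z + d) *: RP1_vec x.
  have ca : cos (atan z) != 0.
    by rewrite lt0r_neq0// cos_gt0_pihalf// atan_gtNpi2 atan_ltpi2.
  have sa : sin (atan z) = z * cos (atan z).
    by rewrite -{2}(atanK z) /tan mulfVK.
  have xh : x / 2 = atan z by rewrite /x; field.
  apply: col2P; rewrite mulmx2E [RHS]mxE !RP1_vecE xh sa -/a -/c -/d -/e.
    by transitivity ((a * z + e) * cos (atan z)); [ring|rewrite zE; ring].
  by ring.
have [k k0 kE] := orbit_spec x j; rewrite xE in kE.
have [l lE] := same_line (lt0r_neq0 k0) (esym kE).
have := Dj x; rewrite lE => h.
have l0 : l < 0 by rewrite -(ltr_int R) -(pmulr_rlt0 _ (x := 2 * pi)); lra.
have l1 : -1 < l.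
  by rewrite -(ltr_int R) -(ltr_pM2l (x := 2 * pi)); lra.
by move: l0 l1; lia.
Qed.

(** Start the orbit at infinity, which is [pi]. Its first steps stay in
    (- pi, pi), since a single step is less than a turn and the positive
    entry excludes the turn from [- pi] down to [- 3 pi]. So the last step
    ends before a second turn. *)
Lemma one_turn (k : int) : (0 < m)%N ->
  (forall j, (j < m)%N -> 0 < T j 1 0) -> D m pi = pi + 2 * pi * k%:~R ->
  k = -1.
Proof.
have p0 := pi_gt0 R.
move=> m0 T0 Dm.
have step y j : (j.+1 = y)%N -> D y pi = D y pi by [].
have H j : (j < m)%N -> - pi < D j pi < pi.
  elim: j => [|j IHj] jm.
    by have := cw_lift_bounds (B 0%N) pi; rewrite /=; lra.
  have := IHj (ltnW jm); have := cw_lift_bounds (B j.+1) (D j pi).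
  rewrite -[cw_lift (B j.+1) (D j pi)]/(D j.+1 pi).
  have [c c0] := T10_orbit j.+1; have := T0 _ jm => + cE; rewrite cE pmulr_rgt0//.
  move: (D j.+1 pi) (D j pi) => u v cu uv hv.
  apply/andP; split; last by lra.
  rewrite ltNge; apply/negP => u1.
  have : 0 <= cos (u / 2 + pi) by apply: cos_ge0_pihalf; lra.
  by rewrite cosDpi; lra.
case: m m0 T0 Dm H => // m' _ _ Dm H.
have := H m' (ltnSn _); have := cw_lift_bounds (B m'.+1) (D m' pi).
rewrite -[cw_lift (B m'.+1) (D m' pi)]/(D m'.+1 pi) Dm => h1 h2.
have l0 : k < 0 by rewrite -(ltr_int R) -(pmulr_rlt0 _ (x := 2 * pi)); lra.
have l1 : -2 < k.
  by rewrite -(ltr_int R) -(ltr_pM2l (x := 2 * pi)); lra.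
by move: l0 l1; lia.
Qed.

End Orbits.

Section SuperMaximal.
Variable R : realType.
Variables (m : nat) (rho : HomPi R m.+1) (b : 'I_m.+1 -> R).

(** The normalized matrices of the generators, in the order in which the
    relator applies them. *)
Definition gen_mx (j : nat) : 'M[R]_2 := norm_mx (rho (puncture_loop (rgen m j))).

Hypothesis m0 : (0 < m)%N.
Hypothesis b0 : forall i, 0 < b i < pi.
Hypothesis eB : forall i, ell (b i) (norm_mx (rho (puncture_loop i))).

Local Notation T j := (rprod mulmx gen_mx j).

(** The Euler class is [m.+1 + k], so super-maximality means [k = -1], the value
    [k = 0] being excluded as the lifts turn clockwise. *)
Lemma super_maximalP :
  super_maximal rho <-> forall j, (j < m)%N -> 0 < T j 1 0.
Proof.
have p0 := pi_gt0 R.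
have [k kE] := lift_relator b0 eB; rewrite /super_maximal (euler_lift b0 eB kE).
have kE' x : rprod comp (fun i => cw_lift (gen_mx i)) m x = x + 2 * pi * k%:~R.
  by rewrite -kE foldr_enum_rprod.
have b0' j : 0 < b (rgen m j) < pi by [].
have eB' j : ell (b (rgen m j)) (gen_mx j) by [].
have k0 : k < 0.
  rewrite -(ltr_int R) -(pmulr_rlt0 _ (x := 2 * pi)); last by lra.
  by have := orbit_lt0 gen_mx 0 m; rewrite kE'; lra.
split=> [[|] e|T0].
- have k1 : k%:~R = -1 :> R by lra.
  move=> j jm; have [] := partial_elliptic b0' eB' (m := m) _ jm => // x.
  by rewrite kE' k1; ring.
- have : k%:~R = 0 :> R by lra.
  by move/eqP; rewrite intr_eq0 => /eqP k00; rewrite k00 ltxx in k0.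
- by left; rewrite (one_turn b0' eB' m0 T0 (kE' _)) rmorphN.
Qed.

Lemma super_maximal_tr : super_maximal rho ->
  forall j, (j < m)%N -> `|\tr (T j)| < 2.
Proof.
have p0 := pi_gt0 R.
move=> /super_maximalP T0.
have [k kE] := lift_relator b0 eB.
have kE' x : rprod comp (fun i => cw_lift (gen_mx i)) m x = x + 2 * pi * k%:~R.
  by rewrite -kE foldr_enum_rprod.
have b0' j : 0 < b (rgen m j) < pi by [].
have eB' j : ell (b (rgen m j)) (gen_mx j) by [].
move=> j jm; have [] := partial_elliptic b0' eB' (m := m) _ jm => // x.
by rewrite kE' (one_turn b0' eB' m0 T0 (kE' _)) rmorphN /=; ring.
Qed.

End SuperMaximal.

(** * The topology of the representation space *)

Lemma cvg_initial (X : Type) (S : choiceType) (T : topologicalType) (f : S -> T)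
    (h : X -> S) (F : set_system X) (s : S) : Filter F ->
  (fun x => f (h x)) @ F --> f s -> h @ F --> (s : initial_topology f).
Proof.
move=> FF hf A; rewrite nbhsE /= => -[B [[C oC <-] Cs] BA].
have FC : F [set x | C (f (h x))] by apply: hf; apply: open_nbhs_nbhs.
by apply: (@filterS _ F FF _ _ _ FC) => x Cx; exact: BA.
Qed.

Lemma cvg_ptws (X : Type) (U : Type) (V : topologicalType)
    (h : X -> {ptws U -> V}) (F : set_system X) (f : {ptws U -> V}) : Filter F ->
  (forall t, (fun x => h x t) @ F --> f t) -> h @ F --> f.
Proof.
move=> FF hf; apply/cvg_sup => t.
exact: (@cvg_initial X _ _ (fun f : {ptws U -> V} => f t) h F f FF (hf t)).
Qed.

Lemma cvg_mx2 (X : Type) (T : topologicalType) (h : X -> 'M[T]_2)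
    (F : set_system X) (M : 'M[T]_2) : Filter F ->
  (forall i j, (fun x => h x i j) @ F --> M i j) -> h @ F --> M.
Proof.
move=> FF hM A [P MP PA].
have H i j : \forall x \near F, P i j (h x i j) by apply: (hM i j); exact: MP.
rewrite /nbhs /=; near=> x; apply: PA => /= i j.
by case: (ord2P i) => ->; case: (ord2P j) => ->; near: x; exact: H.
Unshelve. all: by end_near. Qed.

Section Cvg.
Variable R : realType.
Implicit Types (A B : SL2 R).

Lemma cvg_SL2 (X : Type) (h : X -> SL2 R) (F : set_system X) A : Filter F ->
  (forall i j, (fun x => SL2_mx (h x) i j) @ F --> SL2_mx A i j) -> h @ F --> A.
Proof.
move=> FF hA; apply: (@cvg_initial X (SL2 R) _ set_val h F A FF).
exact: cvg_mx2.
Qed.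

Lemma SL2_mx_cvg (X : Type) (h : X -> SL2 R) (F : set_system X) A i j : Filter F ->
  h @ F --> A -> (fun x => SL2_mx (h x) i j) @ F --> SL2_mx A i j.
Proof.
move=> FF hA.
have c1 : continuous (@SL2_mx R).
  exact: (@initial_continuous (SL2 R) 'M[R]_2 set_val).
have h1 : (@SL2_mx R \o h) @ F --> SL2_mx A by apply: (cvg_comp _ _ hA); exact: c1.
have h2 := @coord_continuous R 2 2 i j (SL2_mx A).
exact: (cvg_comp _ _ h1 h2).
Qed.

Lemma cvg_SL2_mul (X : Type) (h k : X -> SL2 R) (F : set_system X) A B : Filter F ->
  h @ F --> A -> k @ F --> B -> (fun x => SL2_mul (h x) (k x)) @ F --> SL2_mul A B.
Proof.
move=> FF hA kB; apply: cvg_SL2 => i j; rewrite SL2_mx_mul mulmx2E.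
under eq_fun do rewrite SL2_mx_mul mulmx2E.
by apply: cvgD; apply: cvgM; apply: SL2_mx_cvg.
Qed.

Lemma SL2_mx_inv A : SL2_mx (SL2_inv A) = adj2 (SL2_mx A).
Proof. by rewrite -invmx_adj2 ?det_SL2. Qed.

Lemma cvg_SL2_inv (X : Type) (h : X -> SL2 R) (F : set_system X) A : Filter F ->
  h @ F --> A -> (fun x => SL2_inv (h x)) @ F --> SL2_inv A.
Proof.
move=> FF hA; apply: cvg_SL2 => i j; rewrite SL2_mx_inv.
under eq_fun do rewrite SL2_mx_inv.
have H i' j' : (fun x => SL2_mx (h x) i' j') @ F --> SL2_mx A i' j'.
  exact: SL2_mx_cvg.
have N i' j' : (fun x => - SL2_mx (h x) i' j') @ F --> - SL2_mx A i' j'.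
  by apply: (@cvgN _ R^o); apply: H.
case: (ord2P i) => ->; case: (ord2P j) => ->; rewrite !mx2E;
  under eq_fun do rewrite mx2E; by [apply: H|apply: N].
Qed.

Lemma pi_PSL2_mul A B : \pi_(PSL2 R) (SL2_mul A B) = (\pi_(PSL2 R) A * \pi_(PSL2 R) B)%g.
Proof.
apply/pi_pm_eq; apply: pm_eq_mul; rewrite pm_eq_sym; exact: repr_pi_pm.
Qed.

Lemma pi_PSL2_inv A : \pi_(PSL2 R) (SL2_inv A) = (\pi_(PSL2 R) A)^-1%g.
Proof.
apply: (mulgI (\pi_(PSL2 R) A)); rewrite mulgV -pi_PSL2_mul.
apply/pi_pm_eq/pm_eqE; rewrite SL2_mx_mul SL2_mx_inv.
by apply: mul_adj2; exact: det_SL2.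
Qed.

Lemma continuous_conjg (g : PSL2 R) : continuous (fun h : PSL2 R => (h ^ g)%g).
Proof.
apply/quotient_continuous => A.
have -> : (fun h : PSL2 R => (h ^ g)%g) \o \pi_(PSL2 R) = fun A =>
    \pi_(PSL2 R) (SL2_mul (SL2_inv (repr g)) (SL2_mul A (repr g))).
  by apply/funext => B /=; rewrite !pi_PSL2_mul pi_PSL2_inv reprK.
apply: (@continuous_comp _ _ _ (fun A => SL2_mul (SL2_inv (repr g)) (SL2_mul A (repr g)))
  (\pi_(PSL2 R))); last exact: pi_continuous.
apply: (@cvg_SL2_mul _ (fun=> SL2_inv (repr g)) (fun A => SL2_mul A (repr g))
  (nbhs A) (SL2_inv (repr g)) (SL2_mul A (repr g))); first exact: cvg_cst.
apply: (@cvg_SL2_mul _ id (fun=> repr g) (nbhs A) A (repr g)); first exact: cvg_id.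
exact: cvg_cst.
Qed.

(** Products of two entries do not depend on the representing matrix, so they
    are continuous on the quotient. *)
Lemma continuous_entries i j k l :
  continuous (fun g : PSL2 R => PSL2_mx g i j * PSL2_mx g k l).
Proof.
apply: (@repr_comp_continuous _ _ _ (fun A : SL2 R => SL2_mx A i j * SL2_mx A k l)).
  have H A i' j' : (fun B => SL2_mx B i' j') @ A --> SL2_mx A i' j'.
    by apply: (@SL2_mx_cvg _ id (nbhs A) A); exact: cvg_id.
  by move=> A; exact: (cvgM (H A i j) (H A k l)).
move=> A B /eqP/pi_pm_eq /orP[] /eqP ->; first by rewrite eqxx.
by rewrite !mxE mulrNN.
Qed.

(** The sign of the entry [c] is [c / sqrt (c ^+ 2)], so the normalized entries
    are functions of products of two entries. *)
Lemma continuous_norm_mx (g : PSL2 R) i j : PSL2_mx g 1 0 != 0 ->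
  {for g, continuous (fun h => norm_mx h i j)}.
Proof.
move=> g0.
have -> : (fun h => norm_mx h i j) = (fun h : PSL2 R =>
    (PSL2_mx h i j * PSL2_mx h 1 0) / Num.sqrt (PSL2_mx h 1 0 * PSL2_mx h 1 0)).
  apply/funext => h; rewrite mxE -expr2 sqrtr_sqr.
  case: (sgrP (PSL2_mx h 1 0)) => h0; first by rewrite mul0r invr0 mulr0.
    by rewrite mul1r mulfK// lt0r_neq0.
  by rewrite mulN1r invrN mulrN mulfK// ltr0_neq0.
apply: ct_div.
- by rewrite -expr2 sqrtr_sqr normr_eq0.
- exact: continuous_entries.
- apply: ct_comp; first exact: continuous_entries.
  exact: sqrt_continuous.
Qed.

End Cvg.

Section ConjugationElliptic.
Variable R : realType.
Implicit Types (g h : PSL2 R) (H M : 'M[R]_2) (b : R).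

Lemma ell_conj b H M : 0 < b < pi -> \det H = 1 -> ell b M ->
  ell b (adj2 H *m M *m H).
Proof.
move=> b0 dH eM; have [dt _ tr] := eM; split.
- by rewrite !det_mulmx det_adj2 dH dt !mulr1.
- rewrite !mulmx2E !mx2E; have : (H 0 0 != 0) || (H 1 0 != 0).
    rewrite -negb_and; apply/negP => /andP[/eqP p0 /eqP r0].
    move: dH; rewrite det2 p0 r0 mul0r mulr0 subr0 => /eqP.
    by rewrite eq_sym oner_eq0.
  by move=> /(ell_form_gt0 b0 eM); congr (0 < _); ring.
- by rewrite tr_conj2.
Qed.

(** Conjugation preserves the sense of rotation, so it respects the
    normalization. *)
Lemma norm_mx_conj b g h : 0 < b < pi -> ell b (norm_mx g) ->
  norm_mx (g ^ h)%g = adj2 (PSL2_mx h) *m norm_mx g *m PSL2_mx h.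
Proof.
move=> b0 eg; have [_ M0 _] := ell_conj b0 (det_PSL2_mx h) eg.
apply: (norm_mx_of_sign M0); move: M0 => _.
rewrite conjgE mulgA.
have sgn (A B : 'M[R]_2) : A = B \/ A = - B -> - A = B \/ - A = - B.
  by case=> ->; [right|left]; rewrite ?opprK.
have [->|->] := norm_mx_sign (ell_norm_mx_neq0 eg);
have [->|->] := PSL2_mxM (h^-1 * g)%g h; have [->|->] := PSL2_mxM h^-1%g g;
  have [->|->] := PSL2_mxV h; rewrite ?(mulNmx, mulmxN, opprK); by [left|right].
Qed.

End ConjugationElliptic.

Section HomSpace.
Variables (R : realType) (n : nat).
Local Notation Hom := (HomPi R n).
Implicit Types (rho sigma : Hom) (g : PSL2 R).

Lemma cvg_HomPi (X : Type) (h : X -> Hom) (F : set_system X) rho : Filter F ->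
  (forall y, (fun x => h x y) @ F --> rho y) -> h @ F --> rho.
Proof.
move=> FF hy; apply: (@cvg_initial X Hom _ set_val h F rho FF).
exact: cvg_ptws.
Qed.

Lemma continuous_eval y : continuous (fun rho => rho y).
Proof.
move=> rho.
have c1 : continuous (set_val : Hom -> {ptws sphere_group n -> PSL2 R}).
  exact: initial_continuous.
have h2 := @proj_continuous (sphere_group n) (fun=> PSL2 R) y (set_val rho).
exact: (cvg_comp _ _ (c1 rho) h2).
Qed.

Lemma conj_morph rho g : {morph (fun x => rho x ^ g)%g : x y / (x * y)%g}.
Proof. by move=> x y; rewrite HomPiM conjMg. Qed.

Definition hom_conj g rho : Hom :=
  exist _ ((fun x => rho x ^ g)%g : {ptws _ -> _}) (mem_set (conj_morph rho g)).

Lemma continuous_hom_conj g : continuous (hom_conj g).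
Proof.
move=> rho; apply: cvg_HomPi; first exact: nbhs_filter.
move=> y.
change (((fun h : PSL2 R => (h ^ g)%g) \o (fun sigma : Hom => sigma y)) @ rho
  --> ((rho : Hom) y ^ g)%g).
exact: (cvg_comp _ _ (@continuous_eval y rho) (@continuous_conjg R g ((rho : Hom) y))).
Qed.

Lemma pi_hom_conj g rho : \pi_(rep_space R n) (hom_conj g rho) = \pi_(rep_space R n) rho.
Proof. by apply/eqmodP/asboolP; exists g^-1%g => x; rewrite -conjgM mulgV conjg1. Qed.

Lemma pi_hom_eq rho sigma : \pi_(rep_space R n) rho = \pi_(rep_space R n) sigma ->
  exists g, sigma = hom_conj g rho.
Proof.
move=> /eqmodP /asboolP[g gE]; exists g; apply: val_inj; apply/funext => x.
exact: gE.
Qed.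

(** The saturation of an open set is a union of its translates under a group
    of homeomorphisms. *)
Lemma open_pi_rep (W : set Hom) : open W -> open (\pi_(rep_space R n) @` W).
Proof.
move=> oW; change (open (\pi_(rep_space R n) @^-1` (\pi_(rep_space R n) @` W))).
rewrite (_ : _ @^-1` _ = \bigcup_(g in [set: PSL2 R]) (hom_conj g @^-1` W)).
  by apply: bigcup_open => g _; move/continuousP: (@continuous_hom_conj g); exact.
rewrite eqEsubset; split=> [rho /= [sigma Ws /esym/pi_hom_eq[g e]]|rho [g _ /= Wr]].
  by exists g => //=; rewrite -e.
by exists (hom_conj g rho) => //; exact: pi_hom_conj.
Qed.

End HomSpace.

Section SuperMaximalComponent.
Variables (R : realType) (m : nat) (b : 'I_m.+1 -> R).
Hypothesis m0 : (0 < m)%N.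
Hypothesis b0 : forall i, 0 < b i < pi.
Local Notation Hom := (HomPi R m.+1).
Implicit Types (rho sigma : Hom).

(** The representations with the prescribed rotation angles [2 pi - 2 b i]. *)
Definition ell_hom rho : Prop :=
  forall i, ell (b i) (norm_mx (rho (puncture_loop i))).

Local Notation T rho j := (rprod mulmx (gen_mx rho) j).

Lemma gen_mx_conj rho g j : ell_hom rho ->
  gen_mx (hom_conj g rho) j = adj2 (PSL2_mx g) *m gen_mx rho j *m PSL2_mx g.
Proof. by move=> er; exact: norm_mx_conj (er _). Qed.

Lemma rprod_conj (B : nat -> 'M[R]_2) H j : \det H = 1 ->
  rprod mulmx (fun i => adj2 H *m B i *m H) j = adj2 H *m rprod mulmx B j *m H.
Proof.
move=> dH; elim: j => //= j ->.
by rewrite !mulmxA -(mulmxA _ H (adj2 H)) mul_adj2// mulmx1.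
Qed.

Lemma T_conj rho g j : ell_hom rho ->
  T (hom_conj g rho) j = adj2 (PSL2_mx g) *m T rho j *m PSL2_mx g.
Proof.
move=> er; rewrite -rprod_conj ?det_PSL2_mx//.
by apply: eq_rprod => i _; exact: gen_mx_conj.
Qed.

Lemma ell_hom_conj rho g : ell_hom rho -> ell_hom (hom_conj g rho).
Proof.
move=> er i; rewrite [norm_mx _](norm_mx_conj g (b0 i) (er i)).
by apply: ell_conj; rewrite ?det_PSL2_mx.
Qed.

Lemma det_T rho j : ell_hom rho -> \det (T rho j) = 1.
Proof.
move=> er; elim: j => [|j IHj] /=; first by have [] := er (rgen m 0).
by rewrite det_mulmx IHj mulr1; have [] := er (rgen m j.+1).
Qed.

Lemma super_maximal_ell rho j : ell_hom rho -> super_maximal rho -> (j < m)%N ->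
  exists2 t : R, 0 < t < pi & ell t (T rho j).
Proof.
move=> er sm jm; apply: ell_acos; first exact: det_T.
  by have /(super_maximalP m0 b0 er) := sm; exact.
exact: (super_maximal_tr m0 b0 er sm).
Qed.

(** Lower left entries are not invariant, but the sense of rotation of the
    elliptic partial products is. *)
Lemma super_maximal_conj rho g : ell_hom rho -> super_maximal rho ->
  super_maximal (hom_conj g rho).
Proof.
move=> er sm; apply/(super_maximalP m0 b0 (ell_hom_conj g er)) => j jm.
have [t t0 et] := super_maximal_ell er sm jm.
rewrite T_conj//; have [] := ell_conj t0 (det_PSL2_mx g) et => //.
Qed.

Lemma pi_rprod (A : nat -> SL2 R) j :
  \pi_(PSL2 R) (rprod (@SL2_mul R) A j) =
  rprod *%g (fun i => \pi_(PSL2 R) (A i)) j.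
Proof. by elim: j => //= j <-; exact: pi_PSL2_mul. Qed.

Lemma SL2_mx_rprod (A : nat -> SL2 R) j :
  SL2_mx (rprod (@SL2_mul R) A j) = rprod mulmx (fun i => SL2_mx (A i)) j.
Proof. by elim: j => //= j <-. Qed.

Lemma rprod_relator rho :
  rprod *%g (fun j => rho (puncture_loop (rgen m j))) m = 1%g.
Proof.
by rewrite -[RHS](HomPi_relator rho) foldr_enum_rprod//; exact: mulg1.
Qed.

Lemma T_last rho : ell_hom rho -> T rho m = 1%:M \/ T rho m = - 1%:M.
Proof.
move=> er.
have dB j : \det (gen_mx rho j) = 1 by have [] := er (rgen m j).
pose A j := toSL2 (dB j).
have e : \pi_(PSL2 R) (rprod (@SL2_mul R) A m) = 1%g.
  rewrite pi_rprod -[RHS](rprod_relator rho); apply: eq_rprod => j _.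
  by apply: pi_norm_mx => //; exact: ell_norm_mx_neq0 (er _).
have /pi_pm_eq /orP[] : \pi_(PSL2 R) (rprod (@SL2_mul R) A m) = \pi_(PSL2 R) (SL2_one R) by [].
  by move=> /eqP; rewrite SL2_mx_rprod => h; left.
by move=> /eqP; rewrite SL2_mx_rprod => h; right.
Qed.

(** The relator makes the product of all generators but one the inverse of the
    remaining one, up to a sign that super-maximality fixes. *)
Lemma T_pred_last rho : ell_hom rho -> super_maximal rho ->
  T rho m.-1 = - adj2 (gen_mx rho m).
Proof.
move=> er sm; have T0 := (super_maximalP m0 b0 er).1 sm m.-1.
have e : T rho m = gen_mx rho m *m T rho m.-1 by exact: rprod_pred.
have dB : \det (gen_mx rho m) = 1 by have [] := er (rgen m m).
have eT : T rho m.-1 = adj2 (gen_mx rho m) *m T rho m.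
  by rewrite e mulmxA adj2_mul// mul1mx.
have {}T0 : 0 < T rho m.-1 1 0 by apply: T0; rewrite prednK.
have [h|h] := T_last er; rewrite h ?mulmxN mulmx1 in eT => //.
have [_ c0 _] := er (rgen m m); rewrite -/(gen_mx rho m) in c0.
by move: T0; rewrite eT mx2E oppr_gt0 ltNge (ltW c0).
Qed.

(** The triangle inequality bounds the angles of the partial products of a
    super-maximal representation, uniformly away from the parabolic bounds. *)
Lemma super_maximal_tr_bound rho j : ell_hom rho -> super_maximal rho ->
  (j < m)%N -> `|\tr (T rho j)| <=
    2 * Num.max `|cos (b (rgen m 0))| `|cos (b (rgen m m))|.
Proof.
move=> er sm jm.
have /choice[t tP] : forall j, exists t, (j < m)%N ->
    0 < t < pi /\ ell t (T rho j).
  move=> i; have [im|_] := ltnP i m; last by exists 0.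
  by have [t t0 et] := super_maximal_ell er sm im; exists t.
have tS i : (i.+1 < m)%N -> b (rgen m i.+1) + t i <= t i.+1.
  move=> im; have [ti ei] := tP _ (ltnW im); have [ti' ei'] := tP _ im.
  exact: (ell_triangle (b0 _) ti ti' (er _) ei ei').
have tle i k : (i + k < m)%N -> t i <= t (i + k)%N.
  elim: k => [|k IHk]; first by rewrite addn0.
  rewrite addnS => im; apply: le_trans (IHk (ltnW im)) _.
  by have := tS _ im; have := b0 (rgen m (i + k).+1); lra.
have t0E : t 0%N = b (rgen m 0).
  have [t0 e0] := tP _ m0; apply: ell_inj e0 (er _); first exact: t0.
  exact: b0.
have tm : t m.-1 = pi - b (rgen m m).
  have mm : (m.-1 < m)%N by rewrite prednK.
  have [t0 e0] := tP _ mm; rewrite T_pred_last// in e0.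
  have := b0 (rgen m m) => bm.
  by apply: ell_inj e0 (ell_adj (er _)) => //; lra.
have [t0 [_ _ ->]] := tP _ jm.
have h1 : b (rgen m 0) <= t j by rewrite -t0E -[j]add0n tle ?add0n.
have h2 : t j <= pi - b (rgen m m).
  have jm' : (j <= m.-1)%N by rewrite -ltnS prednK.
  by rewrite -tm -(subnKC jm') tle// subnKC// prednK.
have c1 : cos (t j) <= cos (b (rgen m 0)).
  by rewrite cos_le_inv; have := b0 (rgen m 0); lra.
have c2 : - cos (b (rgen m m)) <= cos (t j).
  by rewrite -cos_piB cos_le_inv; have := b0 (rgen m m); lra.
rewrite normrM ger0_norm// ler_pM2l// le_max ler_norml.
have [h|h] := leP 0 (cos (t j)).
  apply/orP; left; have := ler_norm (cos (b (rgen m 0))).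
  have := normr_ge0 (cos (b (rgen m 0))); lra.
by apply/orP; right; rewrite ltr0_norm// ; have := ler_norm (cos (b (rgen m m))); lra.
Qed.

Lemma cos_lt1 (x : R) : 0 < x < pi -> `|cos x| < 1.
Proof.
move=> /sin_gt0_pi sx; have := cos2Dsin2 x; rewrite ltr_norml; nra.
Qed.

Lemma ct_T rho j i k : ell_hom rho ->
  {for rho, continuous (fun sigma => T sigma j i k)}.
Proof.
move=> er.
have cg l i' k' : {for rho, continuous (fun sigma => gen_mx sigma l i' k')}.
  apply: (continuous_comp (f := fun sigma : Hom => sigma (puncture_loop (rgen m l)))
    (g := fun g => norm_mx g i' k')); first exact: continuous_eval.
  exact: continuous_norm_mx (ell_norm_mx_neq0 (er _)).
elim: j i k => [|j IHj] i k; first exact: cg.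
have -> : (fun sigma => T sigma j.+1 i k) = fun sigma =>
    gen_mx sigma j.+1 i 0 * T sigma j 0 k + gen_mx sigma j.+1 i 1 * T sigma j 1 k.
  by apply/funext => sigma; rewrite [rprod _ _ _]/= mulmx2E.
by apply: ctD; apply: ctM.
Qed.

(** The partial products depend continuously on the representation, so their
    positivity is an open condition. If it fails, some lower left entry is
    negative, and stays so nearby, or it vanishes: then the product is not
    elliptic, and the uniform trace bound keeps super-maximal representations
    away. *)
Lemma super_maximal_locally_constant rho : ell_hom rho ->
  \forall sigma \near rho, ell_hom sigma -> (super_maximal sigma <-> super_maximal rho).
Proof.
move=> er.
have [sm|nsm] := pselect (super_maximal rho).
  have T0 := (super_maximalP m0 b0 er).1 sm.
  have H (j : 'I_m) : \forall sigma \near rho, 0 < T sigma j 1 0.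
    exact: (near_gt (@ct_T rho j 1 0 er) (T0 j (ltn_ord j))).
  near=> sigma; move=> es; split=> // _.
  apply/(super_maximalP m0 b0 es) => j jm.
  rewrite -[j]/(nat_of_ord (Ordinal jm)); move: (Ordinal jm) => {jm}j.
  by move: j; near: sigma; apply: filter_forall.
have [j [jm Tj]] : exists j, (j < m)%N /\ T rho j 1 0 <= 0.
  apply: contrapT => h; apply: nsm; apply/(super_maximalP m0 b0 er) => j jm.
  by rewrite ltNge; apply/negP => Tj; apply: h; exists j.
suff : \forall sigma \near rho, ell_hom sigma -> ~ super_maximal sigma.
  by apply: filterS => sigma h es; split=> // sm; case: (h es sm).
move: Tj; rewrite le_eqVlt => /orP[/eqP Tj|Tj]; last first.
  have : \forall sigma \near rho, T sigma j 1 0 < 0.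
    exact: (near_lt (@ct_T rho j 1 0 er) Tj).
  apply: filterS => sigma Ts es /(super_maximalP m0 b0 es)/(_ _ jm).
  by rewrite ltNge ltW.
set K := 2 * Num.max `|cos (b (rgen m 0))| `|cos (b (rgen m m))|.
have K2 : K < 2.
  by rewrite /K gtr_pMr// gt_max !cos_lt1.
have trj : K < `|\tr (T rho j)|.
  apply: lt_le_trans K2 _; rewrite leNgt; apply/negP => h.
  by have := neq0_of_tr_lt2 (det_T j er) h; rewrite Tj eqxx.
have ctr : {for rho, continuous (fun sigma => `|\tr (T sigma j)|)}.
  apply: (@ct_comp R _ rho (fun sigma => \tr (T sigma j)) (fun x => `|x|)).
    have -> : (fun sigma => \tr (T sigma j)) = fun sigma => T sigma j 0 0 + T sigma j 1 1.
      by apply/funext => sigma; rewrite mxtrace2.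
    by apply: ctD; exact: ct_T.
  exact: norm_continuous.
have : \forall sigma \near rho, K < `|\tr (T sigma j)|.
  exact: (near_gt ctr trj).
apply: filterS => sigma h es sm.
by have := super_maximal_tr_bound es sm jm; rewrite leNgt h.
Unshelve. all: by end_near. Qed.

End SuperMaximalComponent.

(** * The parameter space *)

Section ContinuousChains.
Variables (R : realType) (X : topologicalType).
Implicit Types (x : X) (T : X -> 'M[R]_2) (c t psi u v : X -> R).

Definition ct_mx x T : Prop := forall i k, {for x, continuous (fun z => T z i k)}.

Lemma ct_mulmx x T U : ct_mx x T -> ct_mx x U -> ct_mx x (fun z => T z *m U z).
Proof.
move=> cT cU i k.
have -> : (fun z => (T z *m U z) i k) =
    fun z => T z i 0 * U z 0 k + T z i 1 * U z 1 k.
  by apply/funext => z; rewrite mulmx2E.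
by apply: ctD; apply: ctM.
Qed.

Lemma ct_mx2 x (a b c d : X -> R) : {for x, continuous a} -> {for x, continuous b} ->
  {for x, continuous c} -> {for x, continuous d} ->
  ct_mx x (fun z => mx2 (a z) (b z) (c z) (d z)).
Proof.
move=> ca cb cc cd i k.
case: (ord2P i) => ->; case: (ord2P k) => ->.
- by have -> : (fun z => mx2 (a z) (b z) (c z) (d z) 0 0) = a
    by apply/funext => z; rewrite mx2E.
- by have -> : (fun z => mx2 (a z) (b z) (c z) (d z) 0 1) = b
    by apply/funext => z; rewrite mx2E.
- by have -> : (fun z => mx2 (a z) (b z) (c z) (d z) 1 0) = c
    by apply/funext => z; rewrite mx2E.
- by have -> : (fun z => mx2 (a z) (b z) (c z) (d z) 1 1) = d
    by apply/funext => z; rewrite mx2E.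
Qed.

Lemma ct_rot_mx x (b : R) u v : {for x, continuous u} -> {for x, continuous v} ->
  v x != 0 -> ct_mx x (fun z => rot_mx b (u z) (v z)).
Proof.
move=> cu cv v0; have cc (a : R) : {for x, continuous (fun _ : X => a)} by exact: ct_cst.
apply: ct_mx2.
- by apply: ctD; [exact: cc|apply: ct_div => //; apply: ctM].
- apply: ctN; apply: ct_div => //; apply: ctM; first exact: cc.
  by apply: ctD; exact: ct_sqr.
- by apply: ct_div => //; exact: cc.
- by apply: ctB; [exact: cc|apply: ct_div => //; apply: ctM].
Qed.

Lemma ct_step x T (b : R) c t psi : 0 < b -> 0 < c x -> t x < pi ->
  b + c x <= t x -> ell (c x) (T x) -> ct_mx x T ->
  {for x, continuous c} -> {for x, continuous t} -> {for x, continuous psi} ->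
  ct_mx x (fun z => step (T z) b (c z) (t z) (psi z)).
Proof.
move=> b0 c0 tpi bct eT cT cc ct cpsi.
have cpi : 0 < c x < pi by lra.
have bpi : 0 < b < pi by lra.
have sb := sin_gt0_pi bpi; have sc := sin_gt0_pi cpi.
have kk (a : R) : {for x, continuous (fun _ : X => a)} by exact: ct_cst.
have csin (f : X -> R) : {for x, continuous f} -> {for x, continuous (fun z => sin (f z))}.
  by move=> cf; apply: ct_comp cf _; exact: continuous_sin.
have ccos (f : X -> R) : {for x, continuous f} -> {for x, continuous (fun z => cos (f z))}.
  by move=> cf; apply: ct_comp cf _; exact: continuous_cos.
have cch : {for x, continuous (fun z => cosh_side b (c z) (t z))}.
  apply: ct_div.
  - by rewrite mulf_neq0// lt0r_neq0.
  - apply: ctB; last exact: ccos.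
    by apply: ctM; [exact: kk|exact: ccos].
  - by apply: ctM; [exact: kk|exact: csin].
have csh : {for x, continuous (fun z =>
    Num.sqrt (cosh_side b (c z) (t z) ^+ 2 - 1))}.
  apply: ct_comp; last exact: sqrt_continuous.
  by apply: ctB; [exact: ct_sqr|exact: kk].
have cv : {for x, continuous (fun z => cosh_side b (c z) (t z) +
    Num.sqrt (cosh_side b (c z) (t z) ^+ 2 - 1) * sin (psi z))}.
  by apply: ctD => //; apply: ctM => //; exact: csin.
have v0 := step_denom_gt0 b0 c0 tpi bct (psi x).
have vn0 := lt0r_neq0 v0.
have [_ T0 _] := eT; have Tn0 := lt0r_neq0 T0.
have cre : {for x, continuous (fun z => centre_re (T z))}.
  apply: ct_div => //; apply: ctM; last exact: kk.
  by apply: ctB.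
have cim : {for x, continuous (fun z => centre_im (c z) (T z))}.
  by apply: ct_div => //; exact: csin.
apply: ct_rot_mx.
- apply: ctD => //; apply: ct_div => //; apply: ctM => //; apply: ctM => //.
  exact: ccos.
- exact: ct_div.
- by rewrite lt0r_neq0// divr_gt0// centre_im_gt0.
Qed.

Variables (b : nat -> R) (p : nat) (s psi : X -> nat -> R) (x : X).
Hypothesis b0 : forall k, (k <= p)%N -> 0 < b k.
Hypothesis s0 : forall k, (0 < k <= p)%N -> 0 <= s x k.
Hypothesis angle_pi : angle b (s x) p < pi.
Hypothesis cs : forall k, {for x, continuous (fun z => s z k)}.
Hypothesis cpsi : forall k, {for x, continuous (fun z => psi z k)}.

Lemma ct_angle j : {for x, continuous (fun z => angle b (s z) j)}.
Proof.
elim: j => [|j IHj]; first exact: ct_cst.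
by apply: ctD => //; apply: ctD => //; exact: ct_cst.
Qed.

Lemma ct_chain j : (j <= p)%N ->
  ct_mx x (fun z => chain b (s z) (psi z) j) /\
  ct_mx x (fun z => chain_prod b (s z) (psi z) j).
Proof.
elim: j => [|j IHj] jp; first by split=> i k; exact: ct_cst.
have [_ cT] := IHj (ltnW jp).
have [_ eT] := ell_chain b0 s0 angle_pi (psi x) (ltnW jp).
have cS : ct_mx x (fun z => chain b (s z) (psi z) j.+1).
  apply: ct_step => //; [exact: b0|exact: (angle_gt0 b0 s0 (ltnW jp))| | |
    exact: ct_angle|exact: ct_angle].
  - exact: angle_ltpi b0 s0 angle_pi _ jp.
  - exact: (angle_step b s0 jp).
split=> //; exact: ct_mulmx.
Qed.

Lemma ct_closed_chain j : ct_mx x (fun z => closed_chain b (s z) (psi z) p j).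
Proof.
rewrite /closed_chain; have [jp|_] := leqP j p; first by have [] := ct_chain jp.
have [_ cT] := ct_chain (leqnn p) => i k.
have -> : (fun z => (- adj2 (chain_prod b (s z) (psi z) p)) i k) = fun z =>
   mx2 (- chain_prod b (s z) (psi z) p 1 1) (chain_prod b (s z) (psi z) p 0 1)
       (chain_prod b (s z) (psi z) p 1 0) (- chain_prod b (s z) (psi z) p 0 0) i k.
  apply/funext => z; rewrite [LHS]mxE /adj2.
  by case: (ord2P i) => ->; case: (ord2P k) => ->; rewrite !mx2E ?opprK.
by apply: ct_mx2 => //; exact: ctN.
Qed.

End ContinuousChains.

Section ParameterSpace.
Variables (R : realType) (p : nat) (b : nat -> R).
Local Notation V := 'rV[R]_(p.+1 + p).+1.
Implicit Types x y : V.

Definition defect_of x (j : nat) : R := x 0 (inord j).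
Definition direction_of x (j : nat) : R := x 0 (inord (p.+1 + j)).

(** Nonnegative defects with a prescribed sum form a simplex; the directions
    range over a cube. *)
Definition chain_params : set V :=
  [set x : V | (forall i, 0 <= x 0 i <= 2 * pi) /\
           angle b (defect_of x) p = pi - b p.+1].

Lemma angle_affine (u : R) (s t : nat -> R) j :
  angle b (fun i => (1 - u) * s i + u * t i) j =
  (1 - u) * angle b s j + u * angle b t j.
Proof. by elim: j => /= [|j ->]; ring. Qed.

Lemma compact_chain_params : compact chain_params.
Proof.
pose J : set R := `[0, 2 * pi]%classic.
have box : compact [set x : V | forall i, J (x 0 i)].
  by apply: (@rV_compact _ _ (fun=> J)) => i; exact: segment_compact.
apply: (subclosed_compact _ box) => [|x [h _] i]; last by rewrite /J /= in_itv /=.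
have c1 (i : 'I_(p.+1 + p).+1) : continuous (fun x : V => x 0 i).
  exact: coord_continuous.
have -> : chain_params = (\bigcap_(i in [set: 'I_(p.+1 + p).+1])
    ((fun x : V => x 0 i) @^-1` J)) `&`
    ((fun x : V => angle b (defect_of x) p) @^-1` [set pi - b p.+1]).
  rewrite eqEsubset; split=> [x [h1 h2]|x [h1 h2]].
    by split=> // i _; rewrite /J /= in_itv /=.
  by split=> // i; have := h1 i I; rewrite /J /= in_itv /=.
apply: closedI.
  apply: closed_bigI => i _.
  by apply: (continuous_closedP _).1; [exact: c1|exact: itv_closed].
apply: (continuous_closedP _).1; last exact: closed_eq.
by move=> x; apply: ct_angle => k; exact: c1.
Qed.

Lemma chain_params_convex x y (u : R) : 0 <= u <= 1 ->
  chain_params x -> chain_params y ->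
  chain_params ((1 - u) *: x + u *: y).
Proof.
have p0 := pi_gt0 R.
move=> u01 [hx ax] [hy ay]; split=> [i|].
  rewrite !mxE; have := hx i; have := hy i.
  move: (x 0 i) (y 0 i) => r t rt ry; nra.
have -> : defect_of ((1 - u) *: x + u *: y) =
    fun i => (1 - u) * defect_of x i + u * defect_of y i.
  by apply/funext => i; rewrite /defect_of !mxE.
by rewrite angle_affine ax ay; ring.
Qed.

(** A convex set is the union of its segments from one of its points. *)
Lemma connected_chain_params : connected chain_params.
Proof.
have [->|/set0P[x0 Kx0]] := eqVneq chain_params set0; first exact: connected0.
pose S y := [set (1 - u) *: x0 + u *: y | u in `[0, 1 : R]].
have -> : chain_params = \bigcup_(y in chain_params) S y.
  rewrite eqEsubset; split=> [y Ky|_ [y Ky [u u01 <-]]].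
    exists y => //; exists 1; first by rewrite /= in_itv /= ler01 lexx.
    by rewrite subrr scale0r add0r scale1r.
  by apply: chain_params_convex => //; move: u01; rewrite /= in_itv.
apply: bigcup_connected => [|y Ky].
  exists x0 => y Ky; exists 0; first by rewrite /= in_itv /= ler01 lexx.
  by rewrite subr0 scale1r scale0r addr0.
apply: connected_continuous_connected; first exact: segment_connected.
apply: continuous_subspaceT => u.
have h1 : (fun u : R => (1 - u) *: x0) @ u --> (1 - u) *: x0.
  by apply: cvgZ; [|exact: cvg_cst]; apply: (@cvgB _ R^o); [exact: cvg_cst|exact: cvg_id].
have h2 : (fun u : R => u *: y) @ u --> u *: y by apply: cvgZ; [exact: cvg_id|exact: cvg_cst].
exact: (cvgD h1 h2).
Qed.

Lemma chain_params_nonempty : (0 < p)%N -> 0 < b p.+1 ->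
  (forall k, (k <= p)%N -> 0 < b k) ->
  angle b (fun=> 0) p + b p.+1 < pi -> chain_params !=set0.
Proof.
move=> p0 bp b0 h; set d := pi - b p.+1 - angle b (fun=> 0) p.
have a0 : 0 < angle b (fun=> 0) p.
  apply: (@lt_le_trans _ _ (b 0%N)); first exact: b0.
  by apply: (@angle_le R b (fun=> 0) p 0 p b0) => //; rewrite leqnn.
have d0 : 0 <= d <= 2 * pi by rewrite /d; have := pi_gt0 R; lra.
(* The whole defect is put on the first triangle. *)
exists (\row_i if nat_of_ord i == 1%N then d else 0); split=> [i|].
  by rewrite mxE; case: eqP => _ //; have := pi_gt0 R; lra.
suff H j : (j <= p)%N -> angle b (defect_of (\row_i if nat_of_ord i == 1%N then d else 0)) j =
    angle b (fun=> 0) j + (if (0 < j)%N then d else 0).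
  by rewrite H// p0 /d; ring.
elim: j => [|j IHj] jp; first by rewrite /= addr0.
rewrite /= IHj ?(ltnW jp)// /defect_of mxE inordK; last by rewrite ltnS; lia.
by case: j {IHj jp} => [|j] /=; ring.
Qed.

End ParameterSpace.

(** * Representations realizing chains *)

Section Realization.
Variables (R : realType) (p : nat) (b : 'I_p.+2 -> R).
Local Notation Hom := (HomPi R p.+2).
Local Notation V := 'rV[R]_(p.+1 + p).+1.
Implicit Types (x y : V) (rho : Hom).

Hypothesis b0 : forall i, 0 < b i < pi.

Local Notation bb := (fun j => b (rgen p.+1 j)).
Local Notation K := (@chain_params R p bb).

Lemma trivial_relator (n : nat) :
  foldr *%g 1%g [seq (1 : PSL2 R)%g | i <- enum 'I_n] = 1%g.
Proof. by elim: (enum 'I_n) => //= i s ->; rewrite mulg1. Qed.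

Definition SL2_of (M : 'M[R]_2) : SL2 R :=
  if pselect (\det M = 1) is left dM then toSL2 dM else SL2_one R.

Lemma SL2_ofK (M : 'M[R]_2) : \det M = 1 -> SL2_mx (SL2_of M) = M.
Proof. by rewrite /SL2_of; case: pselect. Qed.

Definition chain_mx x j : 'M[R]_2 :=
  closed_chain bb (defect_of x) (direction_of x) p j.

Definition chain_gen x (i : 'I_p.+2) : SL2 R := SL2_of (chain_mx x (p.+1 - i)).

Definition chain_loop x (i : 'I_p.+2) : PSL2 R := \pi_(PSL2 R) (chain_gen x i).

(* Outside the parameter space, where the relator may fail, the value is the
   trivial representation. *)
Definition chain_hom x : Hom :=
  if pselect (foldr *%g 1%g [seq chain_loop x i | i <- enum 'I_p.+2] = 1%g)
    is left e then mk_hom e else mk_hom (trivial_relator p.+2).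

Section OnParameters.
Variable x : V.
Hypothesis Kx : K x.

Let bb0 k : (k <= p)%N -> 0 < bb k.
Proof. by have /andP[] := b0 (rgen p.+1 k). Qed.

Let s0 k : (0 < k <= p)%N -> 0 <= defect_of x k.
Proof. by have [h _] := Kx; have /andP[] := h (inord k). Qed.

Let api : angle bb (defect_of x) p < pi.
Proof. by have [_ ->] := Kx; have := b0 (rgen p.+1 p.+1); lra. Qed.

Let aE : angle bb (defect_of x) p = pi - bb p.+1.
Proof. by have [_ ->] := Kx. Qed.

Lemma ell_chain_mx j : (j <= p.+1)%N -> ell (bb j) (chain_mx x j).
Proof. exact: (ell_closed_chain bb0 s0 api (direction_of x) aE). Qed.

Lemma SL2_mx_chain_gen (i : 'I_p.+2) : SL2_mx (chain_gen x i) = chain_mx x (p.+1 - i).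
Proof. by apply: SL2_ofK; have [] := ell_chain_mx (leq_subr i p.+1). Qed.

Lemma rgenK j : (j <= p.+1)%N -> (p.+1 - rgen p.+1 j)%N = j.
Proof. by move=> jp; rewrite /rgen inordK ?subKn// ltnS leq_subr. Qed.

Lemma chain_relator :
  foldr *%g 1%g [seq chain_loop x i | i <- enum 'I_p.+2] = 1%g.
Proof.
rewrite foldr_enum_rprod; last exact: mulg1.
rewrite -(pi_rprod (fun j => chain_gen x (rgen p.+1 j))).
apply/pi_pm_eq; rewrite /pm_eq SL2_mx_rprod.
have -> : rprod mulmx (fun i => SL2_mx (chain_gen x (rgen p.+1 i))) p.+1 =
    rprod mulmx (chain_mx x) p.+1.
  by apply: eq_rprod => j jp; rewrite SL2_mx_chain_gen rgenK.
by rewrite (rprod_closed_chain_last bb0 s0 api (direction_of x)) eqxx orbT.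
Qed.

Lemma chain_homE i : chain_hom x (puncture_loop i) = chain_loop x i.
Proof.
rewrite /chain_hom; case: pselect => [e|h]; first exact: mk_hom_loop.
by case: h; exact: chain_relator.
Qed.

Lemma norm_mx_chain_hom i :
  norm_mx (chain_hom x (puncture_loop i)) = chain_mx x (p.+1 - i).
Proof.
rewrite chain_homE norm_mx_pi SL2_mx_chain_gen//.
by have [] := ell_chain_mx (leq_subr i p.+1).
Qed.

Lemma gen_mx_chain_hom j : (j <= p.+1)%N -> gen_mx (chain_hom x) j = chain_mx x j.
Proof. by move=> jp; rewrite /gen_mx norm_mx_chain_hom rgenK. Qed.

Lemma ell_chain_hom : ell_hom b (chain_hom x).
Proof.
move=> i; rewrite norm_mx_chain_hom.
have := ell_chain_mx (leq_subr i p.+1).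
by rewrite rgen_rev.
Qed.

Lemma super_maximal_chain_hom : super_maximal (chain_hom x).
Proof.
apply/(super_maximalP (ltn0Sn p) b0 ell_chain_hom) => j jp.
rewrite (@eq_rprod _ _ _ (chain_mx x)); last first.
  by move=> i ij; apply: gen_mx_chain_hom; apply: leq_trans ij (ltnW jp).
have -> := @rprod_closed_chain R bb (defect_of x) p (direction_of x) j jp.
by have [_ []] := ell_chain bb0 s0 api (direction_of x) jp.
Qed.

End OnParameters.

Lemma cvg_chain_gen x i : K x ->
  (fun y => chain_gen y i) @ within K (nbhs x) --> chain_gen x i.
Proof.
move=> Kx; apply: cvg_SL2 => k l; rewrite (SL2_mx_chain_gen Kx).
have c1 j : {for x, continuous (fun y : V => defect_of y j)}.
  exact: coord_continuous.
have c2 j : {for x, continuous (fun y : V => direction_of y j)}.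
  exact: coord_continuous.
have [h aE] := Kx.
have c : {for x, continuous (fun y => chain_mx y (p.+1 - i) k l)}.
  apply: (ct_closed_chain _ _ _ c1 c2).
  - by move=> j _; have /andP[] := b0 (rgen p.+1 j).
  - by move=> j _; have /andP[] := h (inord j).
  - by rewrite aE; have := b0 (rgen p.+1 p.+1); lra.
have : (fun y => chain_mx y (p.+1 - i) k l) @ within K (nbhs x) -->
    chain_mx x (p.+1 - i) k l by apply: cvg_within_filter; exact: c.
apply: cvg_trans; apply: near_eq_cvg; near=> y.
by rewrite SL2_mx_chain_gen//; near: y; exact: withinT.
Unshelve. all: by end_near. Qed.

Lemma pi_word_eval (n : nat) (A : 'I_n -> SL2 R) (w : seq (letter n)) :
  \pi_(PSL2 R) (word_eval (@SL2_mul R) (SL2_one R) A (fun i => SL2_inv (A i)) w) =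
  word_eval *%g 1%g (fun i => \pi_(PSL2 R) (A i))
    (fun i => (\pi_(PSL2 R) (A i))^-1%g) w.
Proof.
elim: w => //= -[i c] w IHw; rewrite pi_PSL2_mul IHw; congr (_ * _)%g.
by rewrite /letter_eval /=; case: c => //; exact: pi_PSL2_inv.
Qed.

Lemma chain_hom_word x (g : sphere_group p.+2) : K x -> chain_hom x g =
  \pi_(PSL2 R) (word_eval (@SL2_mul R) (SL2_one R) (chain_gen x)
    (fun i => SL2_inv (chain_gen x i)) (repr g)).
Proof.
move=> Kx; rewrite pi_word_eval -{1}[g]reprK HomPi_word.
by elim: (repr g) => //= -[i c] w ->; rewrite /letter_eval /= (chain_homE Kx).
Qed.

Lemma continuous_chain_hom : {within K, continuous chain_hom}.
Proof.
apply/subspace_continuousP => x Kx; apply: cvg_HomPi => g.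
pose W y := word_eval (@SL2_mul R) (SL2_one R) (chain_gen y)
    (fun i => SL2_inv (chain_gen y i)) (repr g).
have cW : W @ within K (nbhs x) --> W x.
  rewrite /W; elim: (repr g) => [|[i c] w IHw]; first exact: cvg_cst.
  apply: cvg_SL2_mul IHw; rewrite /letter_eval /=; case: c; last exact: cvg_chain_gen.
  by apply: cvg_SL2_inv; exact: cvg_chain_gen.
have : (\pi_(PSL2 R) \o W) @ within K (nbhs x) --> chain_hom x g.
  rewrite (chain_hom_word _ Kx); apply: (cvg_comp _ _ cW); exact: pi_continuous.
apply: cvg_trans; apply: near_eq_cvg; near=> y.
by rewrite /= chain_hom_word//; near: y; exact: withinT.
Unshelve. all: by end_near. Qed.

(** The affine map [z |-> v z + u] moves [i] to the centre [u + i v] of [M]. *)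
Lemma centre_at_i c (M : 'M[R]_2) : 0 < c < pi -> ell c M ->
  exists A : SL2 R, adj2 (SL2_mx A) *m M *m SL2_mx A = rot_mx c 0 1.
Proof.
move=> c0 eM; have ME := ell_rotE c0 eM; have y0 := centre_im_gt0 c0 eM.
move: ME y0; set u := centre_re M; set v := centre_im c M => -> v0.
pose r := Num.sqrt v; have r0 : 0 < r by rewrite sqrtr_gt0.
have r2 : v = r ^+ 2 by rewrite sqr_sqrtr// ltW.
have rn0 := lt0r_neq0 r0.
have dA : \det (mx2 r (u / r) 0 r^-1) = 1 by rewrite det2 !mx2E; field.
exists (toSL2 dA); rewrite [SL2_mx _]/= r2.
by apply: mx2P; rewrite !(mulmx2E, mx2E); field.
Qed.

(** After conjugating the centre of the last generator to [i], the partial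
    products form a chain; the relator makes it a closed one. *)
Lemma conj_chain_hom rho : ell_hom b rho -> super_maximal rho ->
  exists2 x, K x & exists g, chain_hom x = hom_conj g rho.
Proof.
move=> er sm; have pi0 := pi_gt0 R.
have [A AE] := centre_at_i (b0 _) (er (rgen p.+1 0)).
have [g gE] : exists g : PSL2 R, PSL2_mx g = SL2_mx A \/ PSL2_mx g = - SL2_mx A.
  by exists (\pi_(PSL2 R) A); exact: PSL2_mx_pi.
pose sigma := hom_conj g rho.
have es : ell_hom b sigma by exact: ell_hom_conj.
have ss : super_maximal sigma by exact: (super_maximal_conj (ltn0Sn p) b0).
have B0 : gen_mx sigma 0 = rot_mx (bb 0%N) 0 1.
  rewrite (gen_mx_conj b0 g 0 er) -AE /gen_mx.
  by have [->|->] := gE; rewrite ?adj2N ?(mulNmx, mulmxN, opprK).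
have /choice[t tP] : forall j, exists t, (j <= p)%N ->
    0 < t < pi /\ ell t (rprod mulmx (gen_mx sigma) j).
  move=> j; have [jp|_] := leqP j p; last by exists 0.
  have [t t0 et] := super_maximal_ell (ltn0Sn p) b0 es ss (j := j) jp.
  by exists t.
have eB j : (j <= p)%N -> 0 < bb j < pi /\ ell (bb j) (gen_mx sigma j).
  by move=> _; split; [exact: b0|exact: es].
have [s [psi [psi0 s0 sp sE]]] := chain_onto eB tP B0.
have tp : t p = pi - bb p.+1.
  have [t0 et] := tP p (leqnn p); have := b0 (rgen p.+1 p.+1) => bp.
  have e := T_pred_last (ltn0Sn p) b0 es ss; rewrite /= in e.
  rewrite e in et; apply: ell_inj et (ell_adj (es _)) => //; lra.
have bb0 k : (k <= p)%N -> 0 < bb k by have /andP[] := b0 (rgen p.+1 k).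
have sle k : (0 < k <= p)%N -> s k <= pi.
  move=> /andP[k0 kp]; apply: le_trans (_ : angle bb s k <= pi).
    case: k k0 kp => // k _ kp /=.
    have api : angle bb s p < pi by rewrite sp tp; have := b0 (rgen p.+1 p.+1); lra.
    have := angle_gt0 bb0 s0 (ltnW kp); have := bb0 _ kp; lra.
  apply: (@le_trans _ _ (angle bb s p)).
    by apply: (angle_le bb0 s0); rewrite kp leqnn.
  by rewrite sp tp; have := b0 (rgen p.+1 p.+1); lra.
pose x : V := \row_i if (nat_of_ord i < p.+1)%N
  then (if nat_of_ord i == 0%N then 0 else s i) else psi (i - p.+1)%N.
have xs j : (0 < j <= p)%N -> defect_of x j = s j.
  move=> /andP[j0 jp]; rewrite /defect_of mxE inordK; last by rewrite ltnS; lia.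
  by rewrite ltnS jp gtn_eqF.
have xp j : (j <= p)%N -> direction_of x j = psi j.
  move=> jp; rewrite /direction_of mxE inordK; last by rewrite ltnS; lia.
  by rewrite ltnNge leq_addr /= addKn.
have aE j : (j <= p)%N -> angle bb (defect_of x) j = angle bb s j.
  by elim: j => //= j IHj jp; rewrite IHj ?(ltnW jp)// xs.
have cE j : (j <= p)%N ->
    chain bb (defect_of x) (direction_of x) j = chain bb s psi j /\
    chain_prod bb (defect_of x) (direction_of x) j = chain_prod bb s psi j.
  elim: j => // j IHj jp; have [_ e] := IHj (ltnW jp).
  rewrite [chain_prod _ _ _ j.+1]/= /chain e.
  by rewrite -![angle _ _ j + _ + _]/(angle _ _ j.+1) !aE ?(ltnW jp)// xp.
have Kx : K x.
  split=> [i|]; last by rewrite aE// sp tp.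
  rewrite mxE; case: ltnP => [ip|_]; last exact: psi0.
  case: eqP => [_|/eqP i0]; first by lra.
  rewrite -lt0n in i0; rewrite ltnS in ip.
  have := s0 i; have := sle i; rewrite i0 ip /= => /(_ isT) h1 /(_ isT) h2; lra.
exists x => //; exists g; apply: HomPi_ext => i.
have ci : chain_mx x (p.+1 - i) = norm_mx (sigma (puncture_loop i)).
  have -> : norm_mx (sigma (puncture_loop i)) = gen_mx sigma (p.+1 - i).
    by rewrite /gen_mx rgen_rev.
  rewrite /chain_mx /closed_chain; have := leq_subr i p.+1.
  rewrite leq_eqVlt ltnS => /orP[/eqP ip|ip].
    rewrite ip ltnn; have [_ ->] := cE p (leqnn p).
    have [_ ->] := sE p (leqnn p).
    have := T_pred_last (ltn0Sn p) b0 es ss => /= ->.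
    by rewrite adj2N adj2K opprK.
  by rewrite ip; have [-> _] := cE _ ip; have [-> _] := sE _ ip.
rewrite (chain_homE Kx) -/sigma /chain_loop.
apply: pi_norm_mx; first exact: ell_norm_mx_neq0 (es i).
by rewrite (SL2_mx_chain_gen Kx).
Qed.

End Realization.

(** * The component of super-maximal classes *)

Section MainTheorem.
Variables (R : realType) (p : nat) (alpha : 'I_p.+2 -> R).
Hypothesis p0 : (0 < p)%N.
Hypothesis alpha0 : forall i, 0 < alpha i < 2 * pi.
Hypothesis sum_alpha : 2 * (p.+2%:R - 1) * pi < \sum_i alpha i.

Local Notation Hom := (HomPi R p.+2).
Local Notation pr := (\pi_(rep_space R p.+2)).
Implicit Types rho sigma : Hom.

Let b i := pi - alpha i / 2.

Let b0 i : 0 < b i < pi.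
Proof. by have := alpha0 i; rewrite /b; lra. Qed.

Lemma theta_ell_hom rho :
  (forall i, theta_i rho i = alpha i) <-> ell_hom b rho.
Proof. by split=> h i; apply/(thetaP _ (alpha0 i)); exact: h. Qed.

Lemma angle_zero (c : nat -> R) j : angle c (fun=> 0) j = \sum_(i < j.+1) c i.
Proof.
elim: j => [|j IHj]; first by rewrite big_ord1.
by rewrite big_ord_recr /= IHj addr0.
Qed.

Local Notation bb := (fun j => b (rgen p.+1 j)).
Local Notation K := (@chain_params R p bb).

Lemma sum_half_angles : angle bb (fun=> 0) p + bb p.+1 < pi.
Proof.
rewrite -[X in X < _]addr0 -[X in X < _]/(angle bb (fun=> 0) p.+1) angle_zero.
have -> : \sum_(j < p.+2) b (rgen p.+1 j) = \sum_(i < p.+2) b i.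
  rewrite [RHS](reindex_inj rev_ord_inj) /=; apply: eq_bigr => j _; congr b.
  by apply: val_inj; rewrite /= inordK ?subSS// ltnS leq_subr.
rewrite sumrB sumr_const card_ord -mulr_suml -mulr_natl.
have := sum_alpha; lra.
Qed.

Lemma RepSM_chain : RepSM alpha = pr @` (@chain_hom R p b @` K).
Proof.
rewrite eqEsubset; split=> [_ [rho [/theta_ell_hom er sm] <-]|_ [_ [x Kx <-] <-]].
  have [x Kx [g xg]] := conj_chain_hom b0 er sm.
  by exists (hom_conj g rho); [exists x|exact: pi_hom_conj].
exists (chain_hom b x) => //; split; last exact: super_maximal_chain_hom.
by apply/theta_ell_hom; exact: ell_chain_hom.
Qed.

Lemma RepSM_nonempty : RepSM alpha !=set0.
Proof.
rewrite RepSM_chain; have [|k _||x Kx] := @chain_params_nonempty R p bb p0.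
- by have /andP[] := b0 (rgen p.+1 p.+1).
- by have /andP[] := b0 (rgen p.+1 k).
- exact: sum_half_angles.
by exists (pr (chain_hom b x)); exists (chain_hom b x) => //; exists x.
Qed.

Let continuous_pr : continuous (pr : Hom -> rep_space R p.+2).
Proof. exact: pi_continuous. Qed.

Lemma RepSM_compact : compact (RepSM alpha).
Proof.
rewrite RepSM_chain; apply: continuous_compact.
  exact: continuous_subspaceT.
apply: continuous_compact; first exact: continuous_chain_hom.
exact: compact_chain_params.
Qed.

Lemma RepSM_connected : connected (RepSM alpha).
Proof.
rewrite RepSM_chain; apply: connected_continuous_connected.
  apply: connected_continuous_connected; last exact: continuous_chain_hom.
  exact: connected_chain_params.
exact: continuous_subspaceT.
Qed.

(** Openness and closedness in [Rep alpha] come from the images [W1] and [W2]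
    of open sets of representations; on [Rep alpha] these images are disjoint
    because super-maximality is invariant under conjugation. *)
Lemma RepSM_component : is_connected_component (Rep alpha) (RepSM alpha).
Proof.
have sub : RepSM alpha `<=` Rep alpha by move=> _ [rho [er _] <-]; exists rho.
have [z0 SMz0] := RepSM_nonempty.
exists z0; first exact: sub.
rewrite eqEsubset; split.
  exact: connected_component_max SMz0 sub RepSM_connected.
set C := connected_component _ _.
pose W1 := [set sigma : Hom | ell_hom b sigma -> super_maximal sigma]°.
pose W2 := [set sigma : Hom | ell_hom b sigma -> ~ super_maximal sigma]°.
have CA : C `<=` Rep alpha by exact: connected_component_sub.
have loc := super_maximal_locally_constant (ltn0Sn p) b0.
have SM_U z : RepSM alpha z -> (pr @` W1) z.
  move=> [rho [/theta_ell_hom er sm] <-]; exists rho => //.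
  by apply: filterS (loc _ er) => sigma h /h ->.
have U_SM z : Rep alpha z -> (pr @` W1) z -> RepSM alpha z.
  move=> [rho /theta_ell_hom er <-] [sigma Ws /esym/pi_hom_eq[g sE]].
  have es : ell_hom b sigma by rewrite sE; exact: ell_hom_conj.
  exists sigma; last by rewrite sE; exact: pi_hom_conj.
  by split; [exact/theta_ell_hom|exact: (interior_subset Ws es)].
have SM_V z : RepSM alpha z -> ~ (pr @` W2) z.
  move=> [rho [/theta_ell_hom er sm] <-] [sigma Ws /esym/pi_hom_eq[g sE]].
  apply: (interior_subset Ws); rewrite sE; first exact: ell_hom_conj.
  exact: (super_maximal_conj (ltn0Sn p) b0).
have V_SM z : Rep alpha z -> ~ (pr @` W2) z -> RepSM alpha z.
  move=> [rho /theta_ell_hom er <-] nV; exists rho => //.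
  split; first exact/theta_ell_hom.
  apply: contrapT => nsm; apply: nV; exists rho => //.
  by apply: filterS (loc _ er) => sigma h /h ->.
suff <- : C `&` RepSM alpha = C by move=> z [].
apply: (component_connected (A := Rep alpha) (x := z0)).
- exists z0; split=> //; apply: connected_component_refl; exact: sub.
- exists (pr @` W1); first by apply: open_pi_rep; exact: open_interior.
  by rewrite eqEsubset; split=> z [Cz h]; split=> //; [exact: SM_U|exact: U_SM (CA _ Cz) h].
- exists (~` (pr @` W2)).
    by apply: open_closedC; apply: open_pi_rep; exact: open_interior.
  by rewrite eqEsubset; split=> z [Cz h]; split=> //; [exact: SM_V|exact: V_SM (CA _ Cz) h].
Qed.

End MainTheorem.

Theorem proposition2p6 (R : realType) (n : nat) (hn : (3 <= n)%N)
    (alpha : 'I_n -> R)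
    (halpha : forall i : 'I_n, 0 < alpha i < 2 * pi)
    (hsum : 2 * (n%:R - 1) * pi < \sum_(i < n) alpha i < 2 * n%:R * pi) :
  [/\ RepSM alpha !=set0,
      compact (RepSM alpha) &
      is_connected_component (Rep alpha) (RepSM alpha)].
Proof.
case: n hn alpha halpha hsum => [|[|[|p]]] // _ alpha halpha /andP[hsum _].
split.
- exact: RepSM_nonempty.
- exact: RepSM_compact.
- exact: RepSM_component.
Qed.
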